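(* Let $p\ge\sqrt{3}$ be a real number, and let $u:\mathbb{R}\times\mathbb{R}\to\mathbb{R}$, $u=u(t,x)$, be a global Schwartz solution of the defocusing generalized KdV equation $$\partial_t u + \partial_x^3 u = \partial_x\big(|u|^{p-1}u\big).$$ Assume that $u$ is soliton-like in the sense that there exist a function $x:\mathbb{R}\to\mathbb{R}$, $t\mapsto x(t)$, and constants $\epsilon>0$ and $C>0$ such that for every $R>0$, $$\sup_{t\in\mathbb{R}} \int_{|x-x(t)|>R} u^2(t,x)\,dx \le \frac{C}{R^{2+\epsilon}}.$$ Then $u\equiv 0$.
   Context: The solution $u$ is real-valued. A global Schwartz solution is a classical solution defined for all times $t\in\mathbb{R}$ such that $u(t,\cdot)$ belongs to the Schwartz class $\mathcal{S}(\mathbb{R})$ for every $t$, with $t\mapsto u(t,\cdot)$ continuously differentiable from $\mathbb{R}$ into $\mathcal{S}(\mathbb{R})$ and the equation holding for all $(t,x)\in\mathbb{R}\times\mathbb{R}$. In the integral, $x$ denotes the integration variable and $x(t)$ the value of the given function at time $t$; no regularity of $t\mapsto x(t)$ is assumed. The constants $C$ and $\epsilon$ are independent of $R$ and $t$. *)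

(* Defs.v *)
From mathcomp Require Import all_boot all_order all_algebra.
From mathcomp Require Import all_classical all_reals all_analysis.
Import Order.TTheory GRing.Theory Num.Theory.
Import numFieldNormedType.Exports.

Set Implicit Arguments.
Unset Strict Implicit.
Unset Printing Implicit Defensive.

Local Open Scope ring_scope.
Local Open Scope classical_set_scope.

Definition smooth (R : realType) (f : R -> R) : Prop :=
  forall (n : nat) (x : R), derivable (derive1n n f) x 1.

(* Meaningful for smooth f only: derive1n is total and has unspecified values
   where f is not n times differentiable. *)
Definition schwartz_seminorm (R : realType) (m n : nat) (f : R -> R) : \bar R :=
  ereal_sup [set (`|x| ^+ m * `|derive1n n f x|)%R%:E | x in [set: R]].

Definition schwartz (R : realType) (f : R -> R) : Prop :=
  smooth f /\ forall m n : nat, (schwartz_seminorm m n f < +oo)%E.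

(* Convergence of g to f along F in the Frechet topology of the Schwartz
   space. Both g and f are meant to take their values in that space. *)
Definition schwartz_cvg (R : realType) (T : Type) (F : set_system T)
    (g : T -> R -> R) (f : R -> R) : Prop :=
  forall m n : nat,
    schwartz_seminorm m n (fun x => g s x - f x) @[s --> F] --> 0%E.

(* t |-> u t is a C^1 curve in the Schwartz space, with derivative v. *)
Definition schwartz_C1 (R : realType) (u : R -> R -> R) : Prop :=
  (forall t : R, schwartz (u t)) /\
  exists v : R -> R -> R,
    [/\ forall t : R, schwartz (v t),
        forall t : R,
          schwartz_cvg (0 : R)^' (fun h x => h^-1 * (u (t + h) x - u t x)) (v t)
      & forall t : R, schwartz_cvg (nbhs t) v (v t)].

Definition gKdV (R : realType) (p : R) (u : R -> R -> R) : Prop :=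
  forall t x : R,
    derive1 (fun s => u s x) t + derive1n 3 (u t) x
    = derive1 (fun y => `|u t y| `^ (p - 1) * u t y) x.

Definition global_schwartz_solution (R : realType) (p : R) (u : R -> R -> R)
  : Prop := schwartz_C1 u /\ gKdV p u.

Definition soliton_like (R : realType) (u : R -> R -> R) : Prop :=
  exists (X : R -> R) (eps C : R),
    [/\ 0 < eps, 0 < C &
      forall r : R, 0 < r ->
        (ereal_sup
           [set \int[lebesgue_measure]_(x in [set x : R | (r < `|x - X t|)%R])
                  (u t x ^+ 2)%R%:E | t in [set: R]]
         <= (C / r `^ (2 + eps))%R%:E)%E].

(* Main.v *)
(** The mass [M = int u^2] and the energy [E = int e],
    [e = u_x^2 / 2 + |u|^(p+1) / (p+1)], are conserved, and the solution moves
    to the left.  The two centers [P / M = int x u^2 / M] and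
    [Q / E = int x e / E] move at different speeds: virial identities give
    [P' = - int (3 u_x^2 + 2p/(p+1) |u|^(p+1))] and, with [f = |u|^(p-1) u],
    [Q' = - int (3/2 u_xx^2 - 2 f u_xx + f^2 / 2)].  Pairing [u] with
    [f - sqrt 3 u_xx] in Cauchy-Schwarz shows, exactly when [p >= sqrt 3], that
    [(E P - M Q)'] is at least a multiple of [(int |u|^(p+1))^2].  The tail
    hypothesis bounds the variance of the mass distribution uniformly in time,
    which keeps [int |u|^(p+1)] away from [0], so [E P - M Q] grows at least
    linearly unless [M = 0].  On the other hand the mass identity with a weight
    growing quadratically around the center of mass, applied over a unit time
    interval, yields by the mean value theorem a time at which the first moment
    of [e] about that center is bounded, hence at which [E P - M Q] is bounded. *)
Require Import Defs.
From mathcomp Require Import all_boot all_order all_algebra.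
From mathcomp Require Import all_classical all_reals all_analysis.
From mathcomp Require Import measurable_realfun.
From mathcomp Require Import ring lra.
Import Order.TTheory GRing.Theory Num.Theory.
Import numFieldNormedType.Exports.

Set Implicit Arguments.
Unset Strict Implicit.
Unset Printing Implicit Defensive.

Local Open Scope ring_scope.
Local Open Scope classical_set_scope.

(** * Rapidly decaying families *)

Section decay.
Context {R : realType} {T : Type} {F : set_system T} {FF : Filter F}.
Implicit Types (f g : T -> R -> R).

(* The bounds hold eventually along [F], with a neighbourhood that may depend on
   [m]; [F] is [nbhs t] for time-dependent families and trivial for a single
   function. *)
Definition rapid f := (forall s, continuous (f s)) /\
  forall m : nat, exists C : R, \forall s \near F, forall x, `|x| ^+ m * `|f s x| <= C.

Definition tempered f := (forall s, continuous (f s)) /\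
  exists (m : nat) (C : R), \forall s \near F, forall x, `|f s x| <= C * (1 + `|x| ^+ m).

Lemma rapid_tempered f : rapid f -> tempered f.
Proof.
move=> [fc /(_ 0%N)[C fC]]; split => //; exists 0%N, C.
apply: filterS fC => s fC x; have := fC x; rewrite !expr0 mul1r => fsx.
by rewrite (le_trans fsx)// ler_peMr ?(le_trans _ fsx)// lerDl.
Qed.

Lemma rapidD f g : rapid f -> rapid g -> rapid (fun s x => f s x + g s x).
Proof.
move=> [fc fC] [gc gC]; split => [s x|m]; first by apply: cvgD; [exact: fc|exact: gc].
have [C fm] := fC m; have [D gm] := gC m; exists (C + D).
apply: filterS2 fm gm => s fm gm x.
rewrite (le_trans _ (lerD (fm x) (gm x)))// -mulrDr.
by rewrite ler_wpM2l ?ler_normD.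
Qed.

Lemma rapidN f : rapid f -> rapid (fun s x => - f s x).
Proof.
move=> [fc fC]; split => [s x|m]; first by apply: cvgN; exact: fc.
have [C fm] := fC m; exists C; apply: filterS fm => s fm x.
by rewrite normrN; exact: fm.
Qed.

Lemma rapidM f g : rapid f -> tempered g -> rapid (fun s x => f s x * g s x).
Proof.
move=> [fc fC] [gc [k [D gD]]]; split => [s x|m].
  by apply: cvgM; [exact: fc|exact: gc].
have [C fm] := fC m; have [C' fmk] := fC (m + k)%N; exists (`|D| * (C + C')).
apply: filterS3 gD fm fmk => s gD fm fmk x.
have -> : `|x| ^+ m * `|f s x * g s x| = `|g s x| * (`|x| ^+ m * `|f s x|).
  by rewrite normrM; ring.
have h : `|g s x| <= `|D| * (1 + `|x| ^+ k).
  by rewrite (le_trans (gD x))// ler_wpM2r ?ler_norm.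
apply: (le_trans (ler_wpM2r _ h)); first by rewrite mulr_ge0 ?exprn_ge0.
rewrite -mulrA ler_wpM2l// mulrDl mul1r lerD ?fm//.
by apply: le_trans (fmk x); rewrite exprD le_eqVlt; apply/orP; left; apply/eqP; ring.
Qed.

Lemma rapidMl f g : tempered f -> rapid g -> rapid (fun s x => f s x * g s x).
Proof.
move=> tf rg; have := rapidM rg tf; congr rapid.
by apply/funext => s; apply/funext => x; rewrite mulrC.
Qed.

Lemma one_add_expn_le (x : R) (m n : nat) :
  1 + `|x| ^+ m <= 2 * (1 + `|x| ^+ (m + n)).
Proof.
have [x1|x1] := leP `|x| 1.
  have := exprn_ile1 m (normr_ge0 x) x1 => h.
  have : 0 <= `|x| ^+ (m + n) by rewrite exprn_ge0.
  lra.
have := ler_weXn2l (ltW x1) (leq_addr n m) => h.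
have : 0 <= `|x| ^+ m by rewrite exprn_ge0.
lra.
Qed.

(** Tempered functions come with different growth exponents; a factor 2 buys every larger exponent
    [m + n], so that sums and products can share one. *)
Lemma tempered_bound f : tempered f -> exists (m : nat) (C : R),
  0 <= C /\ \forall s \near F, forall n x, `|f s x| <= C * (1 + `|x| ^+ (m + n)).
Proof.
move=> [_ [m [C fC]]]; exists m, (`|C| * 2); split; first by rewrite mulr_ge0.
apply: filterS fC => s fC n x; rewrite (le_trans (fC x))// -mulrA.
by rewrite (le_trans (ler_wpM2r _ (ler_norm C)))// ler_wpM2l// one_add_expn_le.
Qed.

Lemma temperedD f g : tempered f -> tempered g -> tempered (fun s x => f s x + g s x).
Proof.
move=> tf tg; split => [s x|]; first by apply: cvgD; [exact: tf.1|exact: tg.1].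
have [k [C [C0 fC]]] := tempered_bound tf; have [l [D [D0 gD]]] := tempered_bound tg.
exists (k + l)%N, (C + D); apply: filterS2 fC gD => s fC gD x.
rewrite (le_trans (ler_normD _ _))// mulrDl lerD// ?fC//.
by rewrite addnC gD.
Qed.

Lemma temperedN f : tempered f -> tempered (fun s x => - f s x).
Proof.
move=> [fc [m [C fC]]]; split => [s x|]; first by apply: cvgN; exact: fc.
by exists m, C; apply: filterS fC => s fC x; rewrite normrN; exact: fC.
Qed.

Lemma temperedM f g : tempered f -> tempered g -> tempered (fun s x => f s x * g s x).
Proof.
move=> tf tg; split => [s x|]; first by apply: cvgM; [exact: tf.1|exact: tg.1].
have [k [C [C0 fC]]] := tempered_bound tf; have [l [D [D0 gD]]] := tempered_bound tg.
exists (k + l)%N, (2 * (C * D) * 2); apply: filterS2 fC gD => s fC gD x.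
have {fC} := fC 0%N x; rewrite addn0 => fC.
have {gD} := gD 0%N x; rewrite addn0 => gD.
rewrite normrM (le_trans (ler_pM _ _ fC gD))//.
have h1 := one_add_expn_le x k l; have := one_add_expn_le x l k; rewrite addnC => h2.
have -> : 2 * (C * D) * 2 * (1 + `|x| ^+ (k + l)) =
  (C * D) * (4 * (1 + `|x| ^+ (k + l))) by ring.
rewrite mulrACA ler_wpM2l ?mulr_ge0//.
have k0 : 0 <= `|x| ^+ k by rewrite exprn_ge0.
have l0 : 0 <= `|x| ^+ l by rewrite exprn_ge0.
by move: h1 h2; rewrite exprD; nra.
Qed.

Lemma bounded_tempered f C : (forall s, continuous (f s)) ->
  (\forall s \near F, forall x, `|f s x| <= C) -> tempered f.
Proof.
move=> fc fC; split => //; exists 0%N, C; apply: filterS fC => s fC x.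
have h := fC x; by rewrite (le_trans h)// ler_peMr ?(le_trans _ h)// lerDl.
Qed.

Lemma tempered_cst (c : R) : tempered (fun _ _ => c).
Proof.
apply: (@bounded_tempered _ `|c|); first by move=> s; exact: cst_continuous.
exact: nearW.
Qed.

Lemma tempered_id : tempered (fun _ x => x).
Proof.
split=> [s x|]; first exact: cvg_id.
by exists 1%N, 1; apply: nearW => s x; rewrite mul1r expr1 lerDr.
Qed.

Lemma temperedX f n : tempered f -> tempered (fun s x => f s x ^+ n).
Proof.
move=> tf; elim: n => [|n IH]; first exact: tempered_cst.
by under eq_fun do under eq_fun do rewrite exprS; exact: temperedM.
Qed.

Lemma rapidX f n : rapid f -> rapid (fun s x => f s x ^+ n.+1).
Proof.
move=> rf; under eq_fun do under eq_fun do rewrite exprS.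
by apply: rapidM => //; apply/temperedX/rapid_tempered.
Qed.

(** The decay bounds of orders 0 and 2 add up to the integrable majorant [C / (1 + x^2)], uniform
    along [F]. *)
Lemma rapid_bound f : rapid f ->
  exists2 C, 0 <= C & \forall s \near F, forall x, `|f s x| <= C * (oneDsqr x)^-1.
Proof.
move=> [_ fC]; have [C0 f0] := fC 0%N; have [C2 f2] := fC 2%N.
exists (`|C0 + C2|) => //; apply: filterS2 f0 f2 => s f0 f2 x.
rewrite ler_pdivlMr ?(lt_le_trans _ (oneDsqr_ge1 x))//.
apply: le_trans (ler_norm _).
apply: le_trans (lerD (f0 x) (f2 x)).
by rewrite /oneDsqr expr0 mul1r mulrDr mulr1 mulrC real_normK ?num_real.
Qed.

End decay.
Arguments rapid {R T} F f.
Arguments tempered {R T} F f.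

(** Follows the shape of the expression, trying either factor of a product as the rapid one. Leaves
    are closed by [assumption] where possible, hence the decay facts at one time recalled before
    many calls. *)
Ltac decay :=
  first [assumption | lazymatch goal with
  | |- rapid _ (fun _ _ => _ + _) => apply: rapidD; decay
  | |- rapid _ (fun _ _ => - _) => apply: rapidN; decay
  | |- rapid _ (fun _ _ => _ ^+ _) => apply: rapidX; decay
  | |- rapid _ (fun _ _ => _ * _) =>
      first [ by apply: rapidM; decay | by apply: rapidMl; decay ]
  | |- tempered _ (fun _ _ => _ + _) => apply: temperedD; decay
  | |- tempered _ (fun _ _ => - _) => apply: temperedN; decay
  | |- tempered _ (fun _ _ => _ ^+ _) => apply: temperedX; decay
  | |- tempered _ (fun _ _ => _ * _) => apply: temperedM; decay
  | |- tempered _ (fun _ x => x) => exact: tempered_id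
  | |- tempered _ _ => first [exact: tempered_cst | by apply: rapid_tempered]
  | |- _ => by []
  end].

Notation rapid1 f := (rapid (globally [set: unit]) (fun _ => f)).
Notation tempered1 f := (tempered (globally [set: unit]) (fun _ => f)).

Lemma rapid_at (R : realType) (T : topologicalType) (t : T) (f : T -> R -> R) :
  rapid (nbhs t) f -> rapid1 (f t).
Proof.
move=> [fc fC]; split => [_|m]; first exact: fc.
by have [C /nbhs_singleton h] := fC m; exists C => s _; exact: h.
Qed.

(** * Integrals of rapidly decaying functions *)

Definition integ {R : realType} (f : R -> R) : R := \int[lebesgue_measure]_x f x.

Section integral.
Context {R : realType}.
Local Notation mu := (@lebesgue_measure R).
Implicit Types f g G : R -> R.

Lemma continuous_measurable_EFin f : continuous f ->
  measurable_fun [set: R] (EFin \o f).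
Proof.
by move=> cf; apply/measurable_EFinP; exact: continuous_measurable_fun.
Qed.

Lemma integrable_oneDsqrV : mu.-integrable [set: R] (EFin \o (fun x : R => (oneDsqr x)^-1)).
Proof.
have h : measurable_fun [set: R] (EFin \o (fun x : R => (oneDsqr x)^-1)).
  by apply: continuous_measurable_EFin; exact: continuous_oneDsqrV.
apply/integrableP. split => //.
have -> : (\int[mu]_x `|(EFin \o (fun x : R => ((oneDsqr x)^-1)%R)) x| =
    \int[mu]_x (((oneDsqr x)^-1)%:E))%E.
  by apply: eq_integral => x _ /=; rewrite ger0_norm.
rewrite ge0_symfun_integralT//=.
- rewrite (_ : [set x | _] = `[0, +oo[%classic); last first.
    by apply/seteqP; split => x/=; rewrite in_itv/= andbT.
  by rewrite integral0y_oneDsqr -EFinM ltry.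
- exact: continuous_oneDsqrV.
- by move=> x/=; rewrite /oneDsqr sqrrN.
Qed.

Lemma rapid1_bound f : rapid1 f ->
  exists2 C, 0 <= C & forall x, `|f x| <= C * (oneDsqr x)^-1.
Proof. by move=> /rapid_bound[C C0 /(_ tt Logic.I)]; exists C. Qed.

Lemma bounded_integrable f C : continuous f ->
  (forall x, `|f x| <= C * (oneDsqr x)^-1) -> mu.-integrable [set: R] (EFin \o f).
Proof.
move=> cf fC; apply: (le_integrable measurableT _ _
  (integrableZl measurableT C integrable_oneDsqrV)).
- exact: continuous_measurable_EFin.
- move=> x _ /=; rewrite lee_fin (le_trans (fC x))//.
  exact: ler_norm.
Qed.

Lemma rapid1_integrable f : rapid1 f -> mu.-integrable [set: R] (EFin \o f).
Proof.
move=> rf; have [C _] := rapid1_bound rf; apply: bounded_integrable.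
exact: (rf.1 tt).
Qed.

Lemma integD f g : rapid1 f -> rapid1 g ->
  integ (fun x => f x + g x) = integ f + integ g.
Proof. by move=> rf rg; rewrite /integ RintegralD//; exact: rapid1_integrable. Qed.

Lemma integB f g : rapid1 f -> rapid1 g ->
  integ (fun x => f x - g x) = integ f - integ g.
Proof. by move=> rf rg; rewrite /integ RintegralB//; exact: rapid1_integrable. Qed.

Lemma integZ c f : rapid1 f -> integ (fun x => c * f x) = c * integ f.
Proof. by move=> rf; rewrite /integ RintegralZl//; exact: rapid1_integrable. Qed.

Lemma le_integ f g : rapid1 f -> rapid1 g -> (forall x, f x <= g x) ->
  integ f <= integ g.
Proof.
by move=> rf rg fg; apply: le_Rintegral => //; exact: rapid1_integrable.
Qed.

Lemma integ_ge0 f : (forall x, 0 <= f x) -> 0 <= integ f.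
Proof. by move=> f0; apply: Rintegral_ge0. Qed.

(** Decay of order 1 compares both values with [harmonic n], that is [1 / (n + 1)]; hence the shift
    to [n.+1]. *)
Lemma rapid1_cvg0 G : rapid1 G ->
  G n.+1%:R @[n --> \oo] --> (0 : R) /\ G (- n.+1%:R) @[n --> \oo] --> (0 : R).
Proof.
move=> [_ /(_ 1%N)[C GC]].
have h y (n : nat) : `|y| = n.+1%:R -> 0 <= `|G y| <= C * harmonic n.
  move=> yn; rewrite normr_ge0/= ler_pdivlMr ?ltr0n// mulrC -yn.
  by have := GC tt Logic.I y; rewrite expr1.
have hC : C * harmonic n @[n --> \oo] --> (0 : R).
  by rewrite -[X in _ --> X](mulr0 C); apply: cvgM; [exact: cvg_cst|exact: cvg_harmonic].
by split; apply: norm_cvg0; apply: (squeeze_cvgr _ (cvg_cst 0) hC);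
  apply: nearW => n; apply: h; rewrite ?normrN normr_nat.
Qed.

(** On [[-(n+1), n+1]] the fundamental theorem of calculus leaves boundary values of [G], which tend
    to 0; dominated convergence recovers the full integral. *)
Lemma integ_derive G g : (forall x : R, is_derive x 1 G (g x)) ->
  rapid1 G -> rapid1 g -> integ g = 0.
Proof.
move=> dG rG rg.
have gi := rapid1_integrable rg.
pose A n := `[- n.+1%:R, n.+1%:R]%classic : set R.
have mA n : measurable (A n) by exact: measurable_itv.
have h1 n : (\int[mu]_x (EFin \o (g \_ (A n))) x)%E = (G n.+1%:R - G (- n.+1%:R))%:E.
  rewrite -restrict_EFin -integral_mkcond.
  rewrite /A /= (@continuous_FTC2 _ g G)//.
  - by rewrite gtrN.
  - by apply: continuous_subspaceT; exact: (rg.1 tt).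
  - split.
    + by move=> x _; exact: ex_derive.
    + by apply: cvg_at_right_filter; exact: (rG.1 tt).
    + by apply: cvg_at_left_filter; exact: (rG.1 tt).
  - by move=> x _; rewrite derive1E; exact: derive_val.
have h2 : (\int[mu]_x (EFin \o (g \_ (A n))) x)%E @[n --> \oo] --> (\int[mu]_x (g x)%:E)%E.
  have [C C0 gC] := rapid1_bound rg.
  apply: (@dominated_cvg _ _ _ mu _ _ (fun n => EFin \o (g \_ (A n))) _
      (EFin \o (fun x : R => C * (oneDsqr x)^-1))) => //.
  - move=> n; rewrite -restrict_EFin; apply: (measurable_int mu).
    apply: (integrable_mkcond _ _).1; first exact: measurable_itv.
    by apply: integrableS gi => //; exact: measurable_itv.
  - move=> x _.
    apply: cvg_near_cst; near=> n; rewrite /= patchE ifT// inE /A /= in_itv/= -ler_norml.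
    near: n; apply: filterS (nbhs_infty_ger `|x|) => n /le_trans; apply.
    by rewrite ler_nat.
  - exact: (integrableZl measurableT C integrable_oneDsqrV).
  - move=> n x _ /=; rewrite lee_fin patchE.
    case: ifP => _; first exact: gC.
    by rewrite normr0 mulr_ge0// invr_ge0.
have h3 : (\int[mu]_x (EFin \o (g \_ (A n))) x)%E @[n --> \oo] --> (0 : R)%:E.
  under eq_fun do rewrite h1.
  apply: cvg_EFin; first exact: nearW.
  have [c1 c2] := rapid1_cvg0 rG.
  by rewrite -[X in _ --> X](subr0 0); apply: cvgB.
rewrite /integ /Rintegral.
by rewrite (cvg_unique _ h2 h3).
Unshelve. all: by end_near. Qed.

Lemma integ_eq0 f : rapid1 f -> (forall x, 0 <= f x) -> integ f = 0 ->
  forall x, f x = 0.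
Proof.
move=> rf f0 if0 x.
apply/eqP; rewrite eq_le f0 andbT leNgt; apply/negP => fx0.
have /cvgrPdist_lt/(_ (f x / 2)) := rf.1 tt x.
rewrite divr_gt0// => /(_ isT)[d /= d0 fd].
(* Halving the radius keeps the closed interval inside the ball where [f] exceeds [f x / 2]; this
   interval alone makes the integral positive. *)
pose A := `[x - d / 2, x + d / 2]%classic : set R.
have fA y : A y -> f x / 2 <= f y.
  rewrite /A/= in_itv/= => Ay.
  have /fd : ball_ Num.norm x d y.
    by rewrite /= ltr_distlC; apply/andP; split; lra.
  by rewrite ltr_distlC; lra.
have h : (\int[mu]_(y in A) (f x / 2)%:E <= \int[mu]_x (f x)%:E)%E.
  apply: (@le_trans _ _ (\int[mu]_(y in A) (f y)%:E)%E).
    apply: ge0_le_integral => //.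
    - exact: measurable_itv.
    - by move=> y _; rewrite lee_fin divr_ge0// ltW.
    - apply: (measurable_funS measurableT) => //.
      by apply: continuous_measurable_EFin; exact: (rf.1 tt).
  apply: ge0_subset_integral => //.
  - exact: measurable_itv.
  - by apply: continuous_measurable_EFin; exact: (rf.1 tt).
  - by move=> y _; rewrite lee_fin.
have cE : (\int[mu]_(y in A) (f x / 2)%:E = (f x / 2)%:E * mu A)%E.
  by rewrite integral_cst//; exact: measurable_itv.
have := h; rewrite {}cE /A lebesgue_measure_itv/=.
have fE : (\int[mu]_x (f x)%:E = (integ f)%:E)%E.
  rewrite /integ /Rintegral fineK//; apply: integrable_fin_num => //.
  exact: rapid1_integrable.
rewrite fE if0 lte_fin ifT; last lra.
rewrite -EFinB -EFinM lee_fin => {h}h.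
have : 0 < f x / 2 * (x + d / 2 - (x - d / 2)).
  by apply: mulr_gt0; lra.
by rewrite ltNge h.
Qed.

(** Decay along [nbhs t] gives one majorant of [F'] for all times near [t], the domination needed to
    differentiate under the integral. *)
Lemma is_derive_integ (t : R) (F F' : R -> R -> R) :
  rapid (nbhs t) F -> rapid (nbhs t) F' ->
  (forall s x : R, is_derive s 1 (F ^~ x) (F' s x)) ->
  is_derive t 1 (fun s => integ (F s)) (integ (F' t)).
Proof.
move=> rF rF' dF.
have [C C0 FC] := rapid_bound rF; have [C' C'0 F'C] := rapid_bound rF'.
have [d /= d0 hd] : nbhs t (fun s => (forall x, `|F s x| <= C / oneDsqr x) /\
    (forall x, `|F' s x| <= C' / oneDsqr x)).
  exact: filterS2 FC F'C.
have {}hd s : `]t - d, t + d[%classic s -> (forall x, `|F s x| <= C / oneDsqr x) /\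
    (forall x, `|F' s x| <= C' / oneDsqr x).
  by rewrite /= in_itv/= => sd; apply: hd; rewrite /= ltr_distlC.
have dF' s x : `]t - d, t + d[%classic s -> [set: R] x -> derivable (F ^~ x) s 1.
  by move=> _ _; apply: ex_derive.
have e s x : partial1of2 F s x = F' s x by rewrite partial1of2E; exact: derive_val.
have tI : `]t - d, t + d[%classic t.
  by rewrite /= in_itv/=; apply/andP; split; lra.
have iF s : `]t - d, t + d[%classic s -> mu.-integrable setT (EFin \o F s).
  by move=> /hd[h _]; apply: bounded_integrable h; exact: rF.1.
have G0 x : 0 <= C' * (oneDsqr x)^-1 by rewrite mulr_ge0// invr_ge0.
have GF s x : `]t - d, t + d[%classic s -> [set: R] x ->
    `|partial1of2 F s x| <= C' * (oneDsqr x)^-1.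
  by move=> /hd[_ h] _; rewrite e.
have iG := integrableZl measurableT C' integrable_oneDsqrV.
have key := differentiation_under_integral measurableT tI iF dF' G0 iG GF.
have dkey := derivable_under_integral measurableT tI iF dF' G0 iG GF.
apply: DeriveDef; first exact: dkey.
rewrite -derive1E key.
by rewrite /integ; apply: eq_Rintegral => x _; rewrite e.
Qed.

End integral.

(** * Pointwise derivatives and powers *)

Section pointwise_derivatives.
Context {R : realType}.
Implicit Types (f g : R -> R) (x a b : R).

Lemma is_derive_add f g x a b : is_derive x 1 f a -> is_derive x 1 g b ->
  is_derive x 1 (fun y => f y + g y) (a + b).
Proof. by move=> df dg; exact: is_deriveD. Qed.

Lemma is_derive_opp f x a : is_derive x 1 f a -> is_derive x 1 (fun y => - f y) (- a).
Proof. by move=> df; exact: is_deriveN. Qed.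

Lemma is_derive_mul f g x a b : is_derive x 1 f a -> is_derive x 1 g b ->
  is_derive x 1 (fun y => f y * g y) (f x * b + g x * a).
Proof. by move=> df dg; exact: is_deriveM. Qed.

Lemma is_derive_expn f n x a : is_derive x 1 f a ->
  is_derive x 1 (fun y => f y ^+ n.+1) (n.+1%:R * f x ^+ n * a).
Proof.
move=> df; elim: n => [|n IH].
  under eq_fun do rewrite expr1.
  by apply: is_derive_eq; rewrite mul1r expr0 mul1r.
under eq_fun do rewrite exprS.
apply: (is_derive_eq (is_derive_mul df IH)).
by rewrite -[n.+2%:R]natr1 exprS; ring.
Qed.

Lemma is_derive_const (c x : R) : is_derive x 1 (fun _ => c) (0 : R).
Proof. exact: is_derive_cst. Qed.

Lemma is_derive_var x : is_derive x 1 (fun y : R => y) 1.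
Proof. exact: is_derive_id. Qed.

Lemma is_derive_compose f g x a b : is_derive (g x) 1 f a -> is_derive x 1 g b ->
  is_derive x 1 (fun y => f (g y)) (a * b).
Proof. by move=> df dg; exact: is_derive1_comp. Qed.

Lemma is_derive_congr f x a b : is_derive x 1 f a -> a = b -> is_derive x 1 f b.
Proof. by move=> + <-. Qed.

Lemma is_derive_continuous f (f' : R -> R) : (forall x, is_derive x 1 f (f' x)) ->
  continuous f.
Proof.
by move=> df x; apply: differentiable_continuous; apply/derivable1_diffP; exact: ex_derive.
Qed.

End pointwise_derivatives.

(* [is_derive] is a type class: an ordinary [refine] or [apply] would start an
   instance search on the remaining premises, which does not terminate in
   practice. *)
Ltac derive_step :=
  lazymatch goal with
  | |- is_derive _ _ (fun _ => ?c) _ => exact: is_derive_const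
  | |- is_derive _ _ (fun y => y) _ => exact: is_derive_var
  | |- is_derive _ _ (fun _ => _ + _) _ => notypeclasses refine (is_derive_add _ _); derive_step
  | |- is_derive _ _ (fun _ => - _) _ => notypeclasses refine (is_derive_opp _); derive_step
  | |- is_derive _ _ (fun _ => _ * _) _ => notypeclasses refine (is_derive_mul _ _); derive_step
  | |- is_derive _ _ (fun _ => _ ^+ _) _ => notypeclasses refine (is_derive_expn _ _); derive_step
  | |- _ => first [eassumption
      | match goal with H : forall _, is_derive _ _ _ _ |- _ => notypeclasses refine (H _) end]
  end.

Ltac derive :=
  notypeclasses refine (is_derive_congr _ _); [derive_step | cbv beta].

Section power.
Context {R : realType}.
Implicit Types q y z : R.

Lemma is_derive_powR q y : 0 < y ->
  is_derive y 1 (fun z => z `^ q) (q * y `^ (q - 1)).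
Proof.
move=> y0; have yp : y \in `]0, +oo[%R by rewrite in_itv/= y0.
apply: DeriveDef; first exact: derivable_powR.
by rewrite -derive1E powR_derive1.
Qed.

Lemma cvg_powR_norm0 q : 0 < q -> `|y| `^ q @[y --> (0 : R)] --> (0 : R).
Proof.
move=> q0; apply/cvgrPdist_lt => e e0.
exists (e `^ q^-1) => /=; first by rewrite powR_gt0.
move=> y /=; rewrite !sub0r !normrN => ye.
rewrite ger0_norm ?powR_ge0//.
have -> : e = (e `^ q^-1) `^ q by rewrite -powRrM mulVf ?gt_eqF// powRr1// ltW.
by apply: gt0_ltr_powR => //; rewrite nnegrE ?powR_ge0.
Qed.

(** The power rule for [y > 0], oddness for [y < 0]; at 0 the difference quotient is [|h|^q], which
    tends to 0. *)
Lemma is_derive_powR_norm q y : 0 < q ->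
  is_derive y 1 (fun z => `|z| `^ q * z) ((q + 1) * `|y| `^ q).
Proof.
move=> q0.
have pos z : 0 < z -> is_derive z 1 (fun z => `|z| `^ q * z) ((q + 1) * `|z| `^ q).
  move=> z0; have d := is_derive_powR q z0.
  have h : is_derive z 1 (fun z => z `^ q * z) ((q + 1) * `|z| `^ q).
    derive; rewrite gtr0_norm// mulr1 mulrCA mulr_powRB1 ?ltW//; ring.
  apply: near_eq_is_derive h; near=> w.
  by rewrite gtr0_norm//; near: w; exact: lt_nbhsr.
have [y0|y0|->] := ltgtP y 0; last 2 first.
- exact: pos.
- rewrite normr0 powR0 ?gt_eqF// mulr0.
  have c : `|z| `^ q @[z --> (0 : R)^'] --> (0 : R).
    by apply: cvg_trans (cvg_powR_norm0 q0); apply: cvg_app; exact: cvg_within.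
  pose f z := `|z| `^ q * z.
  have l : (fun h : R => h^-1 *: (f (h *: (1 : R) + 0) - f 0)) @ (0 : R)^' --> (0 : R).
    apply: cvg_trans c; apply: near_eq_cvg; near=> h; rewrite /f.
    have h0 : h != 0 by near: h; exact: nbhs_dnbhs_neq.
    rewrite mulr0 subr0 addr0 -[h *: (1 : R)]/(h * 1) mulr1 -[RHS]/(_ * _).
    by rewrite mulrCA mulVf// mulr1.
  by apply: DeriveDef; [apply/cvg_ex; exists 0|exact: cvg_lim].
- have := pos (- y); rewrite oppr_gt0 => /(_ y0) h.
  have e : (fun z => `|z| `^ q * z) = (fun z => - (`|- z| `^ q * (- z))).
    by apply/funext => z; rewrite normrN mulrN opprK.
  rewrite e.
  have h' : is_derive y 1 (fun z => `|- z| `^ q * (- z)) ((q + 1) * `|- y| `^ q * (- 1)).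
    apply: (is_derive_compose (f := fun z => `|z| `^ q * z) (g := fun z => - z)) => //.
  apply: (is_derive_congr (is_derive_opp h')).
  by rewrite normrN mulrN mulr1 opprK.
Unshelve. all: by end_near. Qed.

Lemma continuous_powR_norm q : 0 < q -> continuous (fun y => `|y| `^ q).
Proof.
move=> q0 y; have [->|y0] := eqVneq y 0.
  by rewrite /continuous_at /= normr0 powR0 ?gt_eqF//; exact: cvg_powR_norm0.
have ny : 0 < `|y| by rewrite normr_gt0.
apply: (@continuous_comp _ _ _ (fun z : R => `|z|) (fun z => z `^ q)).
  exact: norm_continuous.
apply: differentiable_continuous; apply/derivable1_diffP.
by have := is_derive_powR q ny => h; exact: ex_derive.
Qed.

End power.

(** * Curves in the Schwartz space *)

Section schwartz_facts.
Context {R : realType}.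
Implicit Types (f g : R -> R) (u v : R -> R -> R) (m n : nat) (t x : R).

Lemma schwartz_is_derive f n x : schwartz f ->
  is_derive x 1 (derive1n n f) (derive1n n.+1 f x).
Proof.
by move=> [sf _]; apply: DeriveDef; [exact: sf|rewrite derive1nS derive1E].
Qed.

Lemma schwartz_continuous f n : schwartz f -> continuous (derive1n n f).
Proof.
by move=> sf; apply: is_derive_continuous => x; exact: schwartz_is_derive.
Qed.

Lemma schwartz_seminorm_ub m n f x :
  ((`|x| ^+ m * `|derive1n n f x|)%:E <= schwartz_seminorm m n f)%E.
Proof. by apply: ereal_sup_ubound; exists x. Qed.

Lemma schwartz_rapid f n : schwartz f -> rapid1 (derive1n n f).
Proof.
move=> sf; split=> [_|m]; first exact: schwartz_continuous.
have := sf.2 m n; have := schwartz_seminorm_ub m n f.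
case: (schwartz_seminorm m n f) => [C| |] // ub _.
  by exists C => s _ x; have := ub x; rewrite lee_fin.
(* The remaining seminorm value [-oo] contradicts the lower bound at [x = 0]. *)
by have := ub 0.
Qed.

Lemma schwartz_rapid_bound f n m : schwartz f ->
  exists C : R, forall x, `|x| ^+ m * `|derive1n n f x| <= C.
Proof.
by move=> sf; have [C /(_ tt Logic.I)] := (schwartz_rapid n sf).2 m; exists C.
Qed.

Lemma derive1n_sub f g n : schwartz f -> schwartz g ->
  derive1n n (fun x => f x - g x) = fun x => derive1n n f x - derive1n n g x.
Proof.
move=> sf sg; elim: n => [//|n IH]; apply/funext => x.
rewrite derive1nS IH derive1E.
have df := schwartz_is_derive n x sf; have dg := schwartz_is_derive n x sg.
by have h := is_derive_add df (is_derive_opp dg); exact: derive_val.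
Qed.

Lemma derive1n_diff_quotient (c : R) f g w n : schwartz f -> schwartz g -> schwartz w ->
  derive1n n (fun x => c * (f x - g x) - w x) =
  fun x => c * (derive1n n f x - derive1n n g x) - derive1n n w x.
Proof.
move=> sf sg sw; elim: n => [//|n IH]; apply/funext => x.
rewrite derive1nS IH derive1E.
have df := schwartz_is_derive n x sf; have dg := schwartz_is_derive n x sg.
have dw := schwartz_is_derive n x sw.
suff h : is_derive x 1 (fun x => c * (derive1n n f x - derive1n n g x) - derive1n n w x)
  (c * (derive1n n.+1 f x - derive1n n.+1 g x) - derive1n n.+1 w x).
  exact: derive_val.
derive. by ring.
Qed.

Lemma schwartz_cvg_near (T : Type) {F : set_system T} {FF : Filter F}
    (g : T -> R -> R) f m n (e : R) : 0 < e -> schwartz_cvg F g f ->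
  \forall s \near F, forall x, `|x| ^+ m * `|derive1n n (fun x => g s x - f x) x| <= e.
Proof.
move=> e0 /(_ m n) h.
have h' : \forall s \near F, (schwartz_seminorm m n (fun x => g s x - f x)%R < e%:E)%E.
  apply: (h [set y | (y < e%:E)%E]); apply: open_nbhs_nbhs; split.
    exact: open_ereal_lt_ereal.
  by rewrite /= lte_fin.
apply: filterS h' => s hs x.
by have := le_lt_trans (schwartz_seminorm_ub m n (fun x => g s x - f x) x) hs;
  rewrite lte_fin => /ltW.
Qed.

Section curve.
Variables (u v : R -> R -> R).
Hypotheses (su : forall t, schwartz (u t)) (sv : forall t, schwartz (v t)).
Hypothesis uv : forall t,
  schwartz_cvg (0 : R)^' (fun h x => h^-1 * (u (t + h) x - u t x)) (v t).
Hypothesis cv : forall t, schwartz_cvg (nbhs t) v (v t).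

Lemma curve_quotient_near t m n (e : R) : 0 < e ->
  \forall h \near (0 : R)^', forall x,
   `|x| ^+ m * `|h^-1 * (derive1n n (u (t + h)) x - derive1n n (u t) x) - derive1n n (v t) x| <= e.
Proof.
move=> e0; apply: filterS (schwartz_cvg_near m n e0 (@uv t)) => h hx x.
by have := hx x; rewrite derive1n_diff_quotient.
Qed.

(** The seminorm with [m = 0] controls the difference quotients of the [n]-th space derivative, so
    time and space derivatives commute. *)
Lemma is_derive_curve t x n :
  is_derive t 1 (fun s => derive1n n (u s) x) (derive1n n (v t) x).
Proof.
have l : (fun h : R => h^-1 *: (derive1n n (u (h *: (1 : R) + t)) x - derive1n n (u t) x))
    @ (0 : R)^' --> derive1n n (v t) x.
  apply/cvgrPdist_le => e e0.
  apply: filterS (curve_quotient_near t 0 n e0) => h /(_ x).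
  rewrite expr0 mul1r distrC -[h *: (1 : R)]/(h * 1) mulr1.
  by rewrite (addrC h t).
by apply: DeriveDef; [apply/cvg_ex; exists (derive1n n (v t) x)|exact: cvg_lim].
Qed.

Lemma curve_derivative_rapid t n : rapid (nbhs t) (fun s => derive1n n (v s)).
Proof.
split=> [s|m]; first exact: schwartz_continuous.
have [C vC] := schwartz_rapid_bound n m (sv t).
exists (1 + C); apply: filterS (schwartz_cvg_near m n ltr01 (@cv t)) => s h x.
have := h x; rewrite derive1n_sub// => hx.
apply: le_trans (lerD hx (vC x)); rewrite -mulrDr ler_wpM2l//.
by rewrite -[X in `|X|](subrK (derive1n n (v t) x)) ler_normD.
Qed.

(** Differentiability at [t] suffices: [u s] is [u t] plus [s - t] times a difference quotient that
    stays within 1 of [v t] in the seminorm at hand. *)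
Lemma curve_rapid t n : rapid (nbhs t) (fun s => derive1n n (u s)).
Proof.
split=> [s|m]; first exact: schwartz_continuous.
have [C uC] := schwartz_rapid_bound n m (su t).
have [D vD] := schwartz_rapid_bound n m (sv t).
have [d /= d0 hd] := curve_quotient_near t m n ltr01.
(* [1] is for the quotient minus [v t], [D] for [v t], [C] for [u t]; the factor [s - t] is kept at
   most 1 in absolute value. *)
exists ((1 + D) + C); near=> s => x.
have [->|st] := eqVneq s t.
  rewrite (le_trans (uC x))// lerDr addr_ge0// (le_trans _ (vD x))// mulr_ge0//.
have h0 : s - t != 0 by rewrite subr_eq0.
have hd' : `|0 - (s - t)| < d.
  by rewrite sub0r normrN distrC; near: s; exact: cvgr_dist_lt.
have h1 : `|s - t| <= 1.
  by rewrite distrC; near: s; exact: cvgr_dist_le.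
have := hd (s - t) hd' h0 x; rewrite (addrC t) subrK.
set a := derive1n n (u s) x; set b := derive1n n (u t) x; set c := derive1n n (v t) x.
move=> hx.
have -> : a = (s - t) * (((s - t)^-1 * (a - b) - c) + c) + b by field.
set q := _ - c in hx *.
have hq : `|x| ^+ m * `|q + c| <= 1 + D.
  by apply: le_trans (lerD hx (vD x)); rewrite -mulrDr ler_wpM2l// ler_normD.
apply: le_trans (lerD hq (uC x)); rewrite -mulrDr ler_wpM2l//.
rewrite (le_trans (ler_normD _ _))// lerD2r normrM ler_piMl//.
Unshelve. all: by end_near. Qed.

End curve.
End schwartz_facts.

(** * Tail and moment bounds *)

Section indicator_bounds.
Context {R : realType}.
Local Notation mu := (@lebesgue_measure R).
Implicit Types (f g h : R -> R) (x y r : R).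

Lemma integ_le_itv f y r d : rapid1 f -> 0 < r -> (forall x, f x <= d) ->
  (forall x, r < `|x - y| -> f x <= 0) -> integ f <= 2 * r * d.
Proof.
move=> rf r0 fd f0.
pose A := `[y - r, y + r]%classic : set R.
have mA : mu A = (2 * r)%:E.
  rewrite /A lebesgue_measure_itv/= lte_fin ifT; last lra.
  by rewrite -EFinB; congr (_%:E); ring.
have ic : mu.-integrable A (EFin \o cst d).
  apply/integrableP; split.
    by apply/measurable_EFinP; exact: measurable_cst.
  have cE : (\int[mu]_(x in A) (`|d|%R)%:E = `|d|%:E * mu A)%E.
    by rewrite integral_cst//; exact: measurable_itv.
  by move: cE; rewrite mA -EFinM /comp/= => ->; rewrite ltry.
have icA : mu.-integrable [set: R] (EFin \o (cst d \_ A)).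
  rewrite -restrict_EFin; apply: (integrable_mkcond _ _).1 => //.
  exact: measurable_itv.
have e : \int[mu]_x ((cst d \_ A) x) = d * (2 * r).
  rewrite -Rintegral_mkcond Rintegral_cst.
    exact: (congr1 (fun z => d * fine z) mA).
  exact: measurable_itv.
rewrite mulrC -e; apply: le_Rintegral => //; first exact: rapid1_integrable.
move=> x _; rewrite patchE; case: ifPn => // xA; apply: f0.
rewrite ltNge ler_distl; apply/negP => h; move/negP: xA; apply.
by rewrite inE /A /= in_itv.
Qed.

Lemma integ_le_tail f g h k r y J : rapid1 f -> rapid1 g -> rapid1 h -> 0 <= k ->
  (forall x, f x <= g x + (if r < `|x - y| then k * h x else 0)) ->
  (\int[mu]_(x in [set x : R | (r < `|x - y|)%R]) (h x)%:E <= J%:E)%E ->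
  integ f <= integ g + k * J.
Proof.
move=> rf rg rh k0 fgh hJ.
pose A := [set x : R | (r < `|x - y|)%R].
have AE : A = ~` `[y - r, y + r]%classic.
  apply/seteqP; split=> x; rewrite /A/= in_itv/= -ler_distl leNgt.
    by move=> ->.
  by move/negP; rewrite negbK.
have ih : mu.-integrable A (EFin \o h).
  apply: integrableS (rapid1_integrable rh) => //.
  by rewrite AE; apply: measurableC; exact: measurable_itv.
have ih0 : mu.-integrable [set: R] (EFin \o (h \_ A)).
  rewrite -restrict_EFin; apply: (integrable_mkcond _ _).1 => //.
  by rewrite AE; apply: measurableC; exact: measurable_itv.
have e : \int[mu]_x (k * (h \_ A) x) = k * \int[mu]_(x in A) h x.
  by rewrite RintegralZl// -Rintegral_mkcond.
have hJ' : \int[mu]_(x in A) h x <= J.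
  rewrite -lee_fin /Rintegral fineK//; apply: integrable_fin_num => //.
  by rewrite AE; apply: measurableC; exact: measurable_itv.
have rfg : rapid1 (fun x => f x - g x) by decay.
have : integ (fun x => f x - g x) <= k * J.
  apply: le_trans (ler_wpM2l k0 hJ'); rewrite -e.
  apply: le_Rintegral => //; first exact: rapid1_integrable.
    exact: (integrableZl measurableT k ih0).
  move=> x _; rewrite lerBlDl (le_trans (fgh x))// lerD2l patchE.
  case: ifPn => hx; first by rewrite (mem_set (hx : A x)).
  by rewrite memNset ?mulr0//; exact/negP.
by rewrite integB// lerBlDl.
Qed.

Lemma tempered_min (c : R) y :
  tempered1 (fun x => Num.min ((x - y) ^+ 2) c).
Proof.
have tx : tempered1 (fun x => (x - y) ^+ 2) by decay.
have tb : tempered1 (fun x => (x - y) ^+ 2 + `|c|) by decay.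
have [k [D /(_ tt Logic.I) hD]] := tb.2.
split=> [s x|].
  apply: (@continuous_min R R (fun x => (x - y) ^+ 2) (cst c)).
    exact: (tx.1 tt).
  exact: cst_continuous.
exists k, D => s _ x; apply: le_trans (hD x).
rewrite [leRHS]ger0_norm ?addr_ge0 ?sqr_ge0//.
have s0 : 0 <= (x - y) ^+ 2 by exact: sqr_ge0.
by rewrite /Num.min; case: ifP => _; [rewrite ger0_norm// lerDl|rewrite lerDr].
Qed.

(** Tails of order [r^(-2-eps)] make the dyadic contributions to the second moment summable. The
    bound involves [f] only through its mass, so it can be uniform in time. *)
Lemma second_moment_le f y (C eps : R) : rapid1 f -> 0 < eps -> 0 < C ->
  (forall r, 0 < r -> (\int[mu]_(x in [set x : R | (r < `|x - y|)%R]) (f x ^+ 2)%:E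
     <= (C / r `^ (2 + eps))%:E)%E) ->
  integ (fun x => (x - y) ^+ 2 * f x ^+ 2) <=
    integ (fun x => f x ^+ 2) + 4 * C / (1 - (2 `^ eps)^-1) + 1.
Proof.
move=> rf eps0 C0 tail.
(* [K] is the sum of the geometric series with first term [4 * C] and ratio [q]. *)
set q := (2 `^ eps)^-1; set K := 4 * C / (1 - q).
have q0 : 0 < q by rewrite invr_gt0 powR_gt0.
have q1 : q < 1.
  rewrite invf_lt1 ?powR_gt0//.
  have : (1 : R) `^ eps < 2 `^ eps by apply: gt0_ltr_powR; rewrite ?nnegrE ?ltr1n.
  by rewrite powR1.
have K0 : 0 <= K by rewrite divr_ge0 ?mulr_ge0 ?subr_ge0 ?ltW.
have KE : K * (1 - q) = 4 * C by rewrite /K divfK// gt_eqF// subr_gt0.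
(* Raising the truncation from [4^n] to [4^(n+1)] costs [4^(n+1)] times the mass
   beyond distance [2^n], that is a geometric term of ratio [q = 2^(-eps)]. *)
pose g n x := Num.min ((x - y) ^+ 2) (4 ^+ n) * f x ^+ 2.
have rg n : rapid1 (g n).
  by apply: rapidMl; [exact: tempered_min|decay].
have sq4 n : (4 : R) ^+ n = (2 ^+ n) ^+ 2 by rewrite -exprM mulnC exprM; congr (_ ^+ _); ring.
have step n : integ (g n.+1) <= integ (g n) + 4 ^+ n.+1 * (C / (2 ^+ n) `^ (2 + eps)).
  apply: (@integ_le_tail _ _ (fun x => f x ^+ 2) _ (2 ^+ n) y) => //.
  - by decay.
  - move=> x; rewrite /g; have f0 := sqr_ge0 (f x).
    case: ifPn => [h|].
      apply: (@le_trans _ _ (4 ^+ n.+1 * f x ^+ 2)).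
        by rewrite ler_wpM2r// ge_min lexx orbT.
      by rewrite lerDr mulr_ge0// le_min sqr_ge0 exprn_ge0.
    rewrite -leNgt addr0 => h; rewrite ler_wpM2r//.
    rewrite [leRHS]min_l; first by rewrite ge_min lexx.
    by rewrite sq4 -real_normK ?num_real// lerXn2r ?nnegrE ?exprn_ge0.
  - by apply: tail; rewrite exprn_gt0.
have pw n : 4 ^+ n.+1 * (C / (2 ^+ n) `^ (2 + eps)) = K * (1 - q) * q ^+ n.
  have -> : (2 ^+ n) `^ (2 + eps) = (4 * 2 `^ eps) ^+ n.
    rewrite -powR_mulrn// -powRrM mulrC powRrM powR_mulrn ?powR_ge0//.
    rewrite powRD; last by rewrite gt_eqF//; lra.
    by rewrite powR_mulrn//; congr (_ ^+ _); ring.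
  rewrite KE /q exprMn exprVn exprS.
  field; rewrite ?expf_neq0 ?gt_eqF ?powR_gt0//.
(* Adding the rest [K * q^n] of the series closes the induction: it is the next increment plus
   [K * q^(n+1)]. *)
have bd n : integ (g n) + K * q ^+ n <= integ (fun x => f x ^+ 2) + K.
  elim: n => [|n IH].
    rewrite expr0 mulr1 lerD2r; apply: le_integ => //; first by decay.
    move=> x; rewrite /g expr0 -[leRHS]mul1r ler_wpM2r ?sqr_ge0//.
    by rewrite ge_min lexx orbT.
  apply: le_trans IH; have := step n; rewrite pw exprS; lra.
(* The truncation is removed by [(x - y)^2 <= min((x - y)^2, 4^N) + 4^(-N) (x - y)^4]. The fourth
   moment is finite without a uniform bound, but a large [N] reduces its share to the final [1]. *)
have r4 : rapid1 (fun x => (x - y) ^+ 4 * f x ^+ 2) by decay.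
set m4 := integ (fun x => (x - y) ^+ 4 * f x ^+ 2).
have m40 : 0 <= m4 by apply: integ_ge0 => x; rewrite mulr_ge0 ?sqr_ge0// exprn_even_ge0.
pose n := Num.trunc m4; pose N := n.+1.
have hN : m4 <= 4 ^+ N.
  have h1 : m4 < N%:R by exact: truncnS_gt.
  rewrite (le_trans (ltW h1))// -natrX ler_nat ltnW// ltn_expl//.
have hN0 : 0 < (4 : R) ^+ N by rewrite exprn_gt0.
have h : integ (fun x => (x - y) ^+ 2 * f x ^+ 2) <=
    integ (fun x => g N x + (4 ^+ N)^-1 * ((x - y) ^+ 4 * f x ^+ 2)).
  apply: le_integ; [by decay|apply: rapidD; [exact: rg|by decay]|].
  move=> x; rewrite /g [_^-1 * (_ * _)]mulrA -mulrDl ler_wpM2r ?sqr_ge0//.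
  have s0 := sqr_ge0 (x - y).
  rewrite /Num.min; case: ifPn => [_|].
    by rewrite lerDl mulr_ge0 ?invr_ge0 ?(ltW hN0)// exprn_even_ge0.
  rewrite -leNgt => h.
  have -> : (x - y) ^+ 4 = (x - y) ^+ 2 * (x - y) ^+ 2 by ring.
  rewrite -[leLHS]add0r lerD ?(ltW hN0)// mulrC -mulrA ler_peMr//.
  by rewrite ler_pdivlMr// mul1r.
apply: (le_trans h); rewrite integD//; last by decay.
rewrite integZ//.
have h2 : (4 ^+ N)^-1 * m4 <= 1 by rewrite mulrC ler_pdivrMr// mul1r.
have h3 : 0 <= K * q ^+ N by rewrite mulr_ge0// exprn_ge0// ltW.
apply: lerD h2; apply: le_trans (bd N).
by rewrite lerDl.
Qed.

End indicator_bounds.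

(** * Flux identities at a fixed time *)

Section static_identities.
Context {R : realType}.
Implicit Types (a f g G : R -> R) (x y r : R).

Lemma integ_eq_derive f g G : (forall x, is_derive x 1 G (f x - g x)) ->
  rapid1 f -> rapid1 g -> rapid1 G -> integ f = integ g.
Proof.
move=> dG rf rg rG; apply/eqP; rewrite -subr_eq0 -integB//; apply/eqP.
by apply: (integ_derive dG) => //; decay.
Qed.

(** The nonnegative integral of [(M g - K f)^2] expands to [M (M N - K^2)]. *)
Lemma integ_cauchy_schwarz f g : rapid1 f -> rapid1 g ->
  0 < integ (fun x => f x ^+ 2) ->
  integ (fun x => f x * g x) ^+ 2 <= integ (fun x => f x ^+ 2) * integ (fun x => g x ^+ 2).
Proof.
move=> rf rg; set M := integ _; set N := integ (fun x => g x ^+ 2).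
set K := integ _ => M0.
have : 0 <= integ (fun x => (M * g x - K * f x) ^+ 2).
  by apply: integ_ge0 => x; exact: sqr_ge0.
have -> : (fun x => (M * g x - K * f x) ^+ 2) =
    (fun x => M ^+ 2 * g x ^+ 2 + - (2 * M * K) * (f x * g x) + K ^+ 2 * f x ^+ 2).
  by apply/funext => x; ring.
rewrite !integD; try decay.
rewrite !integZ; try decay.
rewrite -/M -/N -/K.
have -> : M ^+ 2 * N + - (2 * M * K) * K + K ^+ 2 * M = M * (M * N - K ^+ 2) by ring.
by rewrite pmulr_rge0// subr_ge0.
Qed.

(** One time slice: [v] stands for the time derivative of [u], [c] for [|u|^q] and [f] for the
    nonlinearity, with [p = q + 1]. *)
Variables (q : R) (u u1 u2 u3 v v1 c f : R -> R).
Hypotheses (q0 : 0 < q)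
  (du : forall x, is_derive x 1 u (u1 x)) (du1 : forall x, is_derive x 1 u1 (u2 x))
  (du2 : forall x, is_derive x 1 u2 (u3 x)) (dv : forall x, is_derive x 1 v (v1 x))
  (df : forall x, is_derive x 1 f ((q + 1) * c x * u1 x)).
Hypotheses (ru : rapid1 u) (ru1 : rapid1 u1) (ru2 : rapid1 u2) (ru3 : rapid1 u3)
  (rv : rapid1 v) (rv1 : rapid1 v1) (tc : tempered1 c) (rf : rapid1 f).
Hypotheses (fE : forall x, f x = c x * u x) (c0 : forall x, 0 <= c x)
  (pde : forall x, v x = (q + 1) * c x * u1 x - u3 x).

(** Integration by parts of [2 a0 u v], with [2 u f' = 2 (q + 1) / (q + 2) (f u)'] for the nonlinear
    part; the primitive given collects the boundary terms. *)
Lemma integ_mass_flux (a0 a1 a2 a3 : R -> R) :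
  (forall x, is_derive x 1 a0 (a1 x)) -> (forall x, is_derive x 1 a1 (a2 x)) ->
  (forall x, is_derive x 1 a2 (a3 x)) ->
  tempered1 a0 -> tempered1 a1 -> tempered1 a2 -> tempered1 a3 ->
  integ (fun x => a0 x * (2 * u x * v x)) =
  integ (fun x => a3 x * u x ^+ 2 -
    a1 x * (3 * u1 x ^+ 2 + 2 * (q + 1) / (q + 2) * (f x * u x))).
Proof.
move=> d0 d1 d2 t0 t1 t2 t3.
notypeclasses refine (@integ_eq_derive _ _ (fun x =>
  - (2 * a0 x * (u x * u2 x)) + a0 x * u1 x ^+ 2
  + 2 * a1 x * (u x * u1 x) - a2 x * u x ^+ 2
  + 2 * (q + 1) / (q + 2) * a0 x * (f x * u x)) _ _ _ _).
- move=> x; derive; rewrite pde fE; field.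
  by rewrite gt_eqF// addr_gt0.
- by decay.
- by decay.
- by decay.
Qed.

(** With [w = f - u2] the equation reads [v = w'], so the integrand is [(u1 v + w^2 / 2)']. *)
Lemma integ_energy_flux : integ (fun x => u1 x * v1 x + f x * v x) = 0.
Proof.
notypeclasses refine (@integ_derive _ (fun x => u1 x * v x + 2^-1 * (f x - u2 x) ^+ 2) _ _ _ _).
- by move=> x; derive; rewrite pde fE; field.
- by decay.
- by decay.
Qed.

(** With [w = f - u2], the weight [x] leaves minus the integral of [u1 v + w^2 / 2]; a second
    integration by parts turns [u1 v] into [- u2 w]. *)
Lemma integ_energy_center_flux :
  integ (fun x => x * (u1 x * v1 x + f x * v x)) =
  - (3 / 2 * integ (fun x => u2 x ^+ 2) - 2 * integ (fun x => f x * u2 x) +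
     2^-1 * integ (fun x => f x ^+ 2)).
Proof.
rewrite -!integZ -?integB -?integD; try decay.
rewrite -mulN1r -integZ; last by decay.
notypeclasses refine (@integ_eq_derive _ _ (fun x => x * (u1 x * v x + 2^-1 * (f x - u2 x) ^+ 2)
  - u1 x * (f x - u2 x)) _ _ _ _).
- by move=> x; derive; rewrite pde fE; field.
- by decay.
- by decay.
- by decay.
Qed.

Lemma integ_nonlinear_dispersion : integ (fun x => f x * u2 x) <= 0.
Proof.
have -> : integ (fun x => f x * u2 x) = integ (fun x => - ((q + 1) * (c x * u1 x ^+ 2))).
  notypeclasses refine (@integ_eq_derive _ _ (fun x => f x * u1 x) _ _ _ _); [|by decay..].
  by move=> x; derive; ring.
have -> : (fun x => - ((q + 1) * (c x * u1 x ^+ 2))) =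
   (fun x => - 1 * ((q + 1) * (c x * u1 x ^+ 2))).
  by apply/funext => x; rewrite mulN1r.
rewrite integZ; last by decay.
rewrite mulN1r oppr_le0; apply: integ_ge0 => x.
apply: mulr_ge0; first by rewrite addr_ge0// ltW.
by apply: mulr_ge0 => //; exact: sqr_ge0.
Qed.

Lemma integ_dirichlet : integ (fun x => u x * u2 x) = - integ (fun x => u1 x ^+ 2).
Proof.
rewrite -mulN1r -integZ; last by decay.
notypeclasses refine (@integ_eq_derive _ _ (fun x => u x * u1 x) _ _ _ _); [|by decay..].
by move=> x; derive; ring.
Qed.

Let M := integ (fun x => u x ^+ 2).
Let A := integ (fun x => u1 x ^+ 2).
Let B := integ (fun x => f x * u x).

(** The coefficients [3 / 2] of [u2^2] and [1 / 2] of [f^2] have ratio 3, so half of Cauchy-Schwarz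
    for [u] and [f - sqrt 3 u2] matches both at once. *)
Lemma centers_separate : Num.sqrt 3 <= q + 1 -> 0 < M ->
  2^-1 * (q / (q + 2)) ^+ 2 * B ^+ 2 <=
  M * (3 / 2 * integ (fun x => u2 x ^+ 2) - 2 * integ (fun x => f x * u2 x) +
     2^-1 * integ (fun x => f x ^+ 2))
  - (2^-1 * A + B / (q + 2)) * (3 * A + 2 * (q + 1) / (q + 2) * B).
Proof.
move=> hq M0.
set D := integ (fun x => u2 x ^+ 2); set H := integ (fun x => f x * u2 x).
set F := integ (fun x => f x ^+ 2); set r := Num.sqrt 3 in hq *.
have r2 : r ^+ 2 = 3 by rewrite sqr_sqrtr.
have r0 : 0 <= r by exact: sqrtr_ge0.
have A0 : 0 <= A by apply: integ_ge0 => x; exact: sqr_ge0.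
have B0 : 0 <= B.
  by apply: integ_ge0 => x; rewrite fE -mulrA mulr_ge0// -expr2 sqr_ge0.
have H0 : H <= 0 by exact: integ_nonlinear_dispersion.
have cs : (B + r * A) ^+ 2 <= M * (F - 2 * r * H + r ^+ 2 * D).
  have rg : rapid1 (fun x => f x - r * u2 x) by decay.
  have := integ_cauchy_schwarz ru rg M0.
  have -> : integ (fun x => u x * (f x - r * u2 x)) = B + r * A.
    have -> : (fun x => u x * (f x - r * u2 x)) = (fun x => f x * u x - r * (u x * u2 x)).
      by apply/funext => x; ring.
    rewrite integB; [|by decay..].
    by rewrite integZ; [rewrite integ_dirichlet mulrN opprK|by decay].
  have -> // : integ (fun x => (f x - r * u2 x) ^+ 2) = F - 2 * r * H + r ^+ 2 * D.
  have -> : (fun x => (f x - r * u2 x) ^+ 2) =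
      (fun x => f x ^+ 2 - 2 * r * (f x * u2 x) + r ^+ 2 * u2 x ^+ 2).
    by apply/funext => x; ring.
  rewrite integD; [|by decay..].
  by rewrite integB; [rewrite !integZ; by decay|by decay..].
have r2' : r <= 2 by nra.
have k0 : 0 < q + 2 by lra.
have ab : 0 <= A * B by rewrite mulr_ge0.
(* With [p = q + 1] this is [p + 3 <= sqrt 3 * (p + 1)], i.e. [p >= sqrt 3]. *)
have coef : (q + 4) / (q + 2) <= r.
  by rewrite ler_pdivrMr//; nra.
(* The target contains [- 2 H], Cauchy-Schwarz only [- r H]; the difference is favourable as
   [H <= 0] and [r <= 2]. *)
have MH : 0 <= M * (- H * (2 - r)).
  by rewrite mulr_ge0 ?mulr_ge0 ?oppr_ge0 ?subr_ge0// ltW.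
(* Against half of [cs], the [A^2] terms cancel, [coef] absorbs [A B], and [B^2] keeps the factor
   [(q / (q + 2))^2 / 2]. *)
have e : (2^-1 * A + B / (q + 2)) * (3 * A + 2 * (q + 1) / (q + 2) * B) =
  3 / 2 * A ^+ 2 + (q + 4) / (q + 2) * (A * B) + 2^-1 * (1 - (q / (q + 2)) ^+ 2) * B ^+ 2.
  by field; rewrite gt_eqF.
have h := ler_wpM2r ab coef.
rewrite e; move: cs h MH; rewrite r2.
have -> : (B + r * A) ^+ 2 = B ^+ 2 + 2 * (r * (A * B)) + r ^+ 2 * A ^+ 2 by ring.
rewrite r2.
set X := (q / (q + 2)) ^+ 2; set Y := (q + 4) / (q + 2) * (A * B); set Z := r * (A * B).
move=> cs h MH; nra.
Qed.

End static_identities.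

(** * Weights, mean values and concentration *)

Section weight.
Context {R : realType}.
Implicit Types (x y : R).

(* Witness: [a0 x = (x - y) * sqrt (1 + (x - y)^2)], a smooth [(x - y) |x - y|]. *)
Lemma quadratic_weight y : exists a0 a1 a2 a3 : R -> R,
  [/\ (forall x, is_derive x 1 a0 (a1 x)), (forall x, is_derive x 1 a1 (a2 x)) &
      forall x, is_derive x 1 a2 (a3 x)] /\
  (forall (T : Type) (F : set_system T), Filter F ->
     [/\ tempered F (fun=> a0), tempered F (fun=> a1),
       tempered F (fun=> a2) & tempered F (fun=> a3)]) /\
  forall x, [/\ `|a0 x| <= (x - y) ^+ 2 + 1, `|x - y| <= a1 x & a3 x <= 3].
Proof.
pose s x := Num.sqrt (1 + (x - y) ^+ 2).
have s1 x : 1 + (x - y) ^+ 2 >= 1 by rewrite lerDl sqr_ge0.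
have s2 x : s x ^+ 2 = 1 + (x - y) ^+ 2 by rewrite sqr_sqrtr// (le_trans _ (s1 x)).
have sp x : 0 < 1 + (x - y) ^+ 2 by exact: lt_le_trans (s1 x).
have sge1 x : 1 <= s x by rewrite -[X in X <= _]sqrtr1 ler_wsqrtr.
have s0 x : 0 < s x by rewrite (lt_le_trans _ (sge1 x)).
have sn x : s x != 0 by rewrite gt_eqF.
have ds x : is_derive x 1 s ((x - y) / s x).
  have h : is_derive (1 + (x - y) ^+ 2) 1 (@Num.sqrt R) (2 * s x)^-1.
    exact: is_derive1_sqrt.
  have h2 : is_derive x 1 (fun x => 1 + (x - y) ^+ 2) (2 * (x - y)).
    by derive; ring.
  have h3 := is_derive_compose (g := fun x => 1 + (x - y) ^+ 2) h h2.
  notypeclasses refine (is_derive_congr h3 _).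
  by field; rewrite sn.
pose i x := (s x)^-1.
have i0 x : 0 < i x by rewrite invr_gt0.
have i1 x : i x <= 1 by rewrite invf_le1.
have si x : s x * i x = 1 by rewrite /i mulfV.
have di x : is_derive x 1 i (- (x - y) * i x ^+ 3).
  notypeclasses refine (is_derive_congr (is_deriveV (sn x) (ds x)) _).
  rewrite -[LHS]/(_ * _) /i; field; exact: sn.
exists (fun x => (x - y) * s x), (fun x => 2 * s x - i x),
 (fun x => (x - y) * (2 * i x + i x ^+ 3)), (fun x => 3 * i x ^+ 5).
have E1 x : (x - y) ^+ 2 = s x ^+ 2 - 1 by rewrite s2; ring.
split; first split.
- move=> x; derive; rewrite -/(i x). 
  have -> : (x - y) * ((x - y) / s x) = s x - i x.
    have -> : (x - y) * ((x - y) / s x) = (x - y) ^+ 2 * i x by rewrite /i; ring.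
    rewrite E1 mulrBl mul1r expr2 -mulrA si; ring.
  by ring.
- by move=> x; derive; rewrite -/(i x); ring.
- move=> x; derive.
  have e3 : (x - y) ^+ 2 * i x ^+ 3 = i x - i x ^+ 3.
    transitivity ((s x * i x) ^+ 2 * i x - i x ^+ 3); first by rewrite E1; ring.
    by rewrite si; ring.
  have e5 : (x - y) ^+ 2 * i x ^+ 5 = i x ^+ 3 - i x ^+ 5.
    transitivity (((x - y) ^+ 2 * i x ^+ 3) * i x ^+ 2); first by ring.
    by rewrite e3; ring.
  transitivity (2 * i x + i x ^+ 3 - 2 * ((x - y) ^+ 2 * i x ^+ 3)
    - 3 * ((x - y) ^+ 2 * i x ^+ 5)); first by ring.
  by rewrite e3 e5; ring.
split.
- move=> T F FF.
  have sc : continuous s by exact: (is_derive_continuous ds).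
  have ic : continuous i by exact: (is_derive_continuous di).
  have ti : tempered F (fun=> i).
    apply: (@bounded_tempered _ _ _ _ _ 1) => //.
    by apply: nearW => _ x; rewrite gtr0_norm.
  have ts : tempered F (fun=> s).
    have t2 : tempered F (fun (_ : T) x => 1 + (x - y) ^+ 2) by decay.
    split; first by move=> _; exact: sc.
    have [k [C h]] := t2.2; exists k, C; apply: filterS h => _ h x.
    apply: le_trans (h x); rewrite -s2 !ger0_norm ?exprn_ge0 ?(ltW (s0 x))//.
    by rewrite expr2 ler_peMr// ltW.
  by split; decay.
- move=> x; have q0 := sqr_ge0 (x - y).
  have xs : `|x - y| <= s x.
    by rewrite -sqrtr_sqr ler_wsqrtr// lerDr.
  split.
  + have -> : (x - y) ^+ 2 + 1 = s x * s x by rewrite -expr2 s2 addrC.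
    by rewrite normrM (gtr0_norm (s0 x)) ler_wpM2r// ltW.
  + have := sge1 x; have := i1 x; lra.
  + have : i x ^+ 5 <= 1 by rewrite exprn_ile1// ltW.
    lra.
Qed.

Lemma mean_value (g g' : R -> R) a b : (forall x, is_derive x 1 g (g' x)) -> a < b ->
  exists2 t, a < t < b & g b - g a = g' t * (b - a).
Proof.
move=> dg ab.
have [t tab e] := MVT ab (fun x _ => dg x) (continuous_subspaceT (is_derive_continuous dg)).
by exists t => //; move: tab; rewrite in_itv.
Qed.

Lemma is_derive0_cst (g : R -> R) a b : (forall x, is_derive x 1 g 0) -> g a = g b.
Proof.
move=> dg; wlog ab : a b / a < b => [H|].
  by case: (ltgtP a b) => [/H|/H|->].
have [t _ /eqP] := mean_value dg ab; rewrite mul0r subr_eq0 => /eqP //.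
Qed.

(* Where [|x - y| > r] use Chebyshev, elsewhere split according to [|u| <= n]. *)
Lemma mass_le_nonlinear (u : R -> R) (q V r n y : R) : 0 < q -> 0 < r -> 0 < n -> rapid1 u ->
  rapid1 (fun x => `|u x| `^ q * u x) ->
  integ (fun x => (x - y) ^+ 2 * u x ^+ 2) <= V ->
  integ (fun x => u x ^+ 2) <=
    V / r ^+ 2 + 2 * r * n ^+ 2 + (n `^ q)^-1 * integ (fun x => `|u x| `^ q * u x * u x).
Proof.
move=> q0 r0 n0 ru rf hV.
have r2 : 0 < r ^+ 2 by rewrite exprn_gt0.
have nq : 0 < n `^ q by rewrite powR_gt0.
have b0 x : 0 <= `|u x| `^ q * u x * u x by rewrite -mulrA mulr_ge0 ?powR_ge0// -expr2 sqr_ge0.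
have w0 x : 0 <= (x - y) ^+ 2 * u x ^+ 2 by rewrite mulr_ge0 ?sqr_ge0.
(* What both comparisons leave of [u^2]: at most [n^2] everywhere, and at most 0 at distance more
   than [r] from [y]. *)
pose g x := u x ^+ 2 - (r ^+ 2)^-1 * ((x - y) ^+ 2 * u x ^+ 2)
  - (n `^ q)^-1 * (`|u x| `^ q * u x * u x).
have rg : rapid1 g by rewrite /g; decay.
have le1 : integ g <= 2 * r * n ^+ 2.
  apply: (integ_le_itv (y := y) rg r0) => x.
    have [un|un] := leP `|u x| n.
      apply: (@le_trans _ _ (u x ^+ 2)).
        by rewrite /g -addrA gerDl -opprD oppr_le0 addr_ge0// mulr_ge0// invr_ge0 ltW.
      by rewrite -real_normK ?num_real// lerXn2r ?nnegrE// ltW.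
    apply: (@le_trans _ _ 0); last by rewrite exprn_ge0// ltW.
    rewrite /g addrAC subr_le0 (@le_trans _ _ 0)//; last by rewrite mulr_ge0// invr_ge0 ltW.
    rewrite subr_le0 mulrC -mulrA -expr2 ler_pdivlMr// mulrC.
    apply: ler_wpM2r; first exact: sqr_ge0.
    by apply: ge0_ler_powR; rewrite ?nnegrE ?(ltW q0) ?(ltW n0) ?(ltW un).
  move=> rx; rewrite /g (@le_trans _ _ 0)// subr_le0.
  rewrite (@le_trans _ _ 0)//; last by rewrite mulr_ge0// invr_ge0 ltW.
  rewrite subr_le0 mulrA ler_peMl ?sqr_ge0// mulrC ler_pdivlMr// mul1r.
  by rewrite -(real_normK (num_real (x - y))) lerXn2r ?nnegrE ?(ltW r0) ?(ltW rx).
move: le1; rewrite /g integB; [|by decay..].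
rewrite integB; [|by decay..].
rewrite !integZ; [|by decay..] => le1.
have := ler_wpM2l (ltW (_ : 0 < (r ^+ 2)^-1)) hV; rewrite invr_gt0 => /(_ r2).
rewrite mulrC [_ * V]mulrC [X in X <= _]mulrC.
move: le1; set a := integ _; set b := integ _; set d := integ _; lra.
Qed.

End weight.

(** * Virial identities in time *)

Lemma tempered1_cst (R : realType) (c : R) : tempered1 (fun _ : R => c).
Proof. exact: tempered_cst. Qed.

Lemma tempered1_id (R : realType) : tempered1 (fun x : R => x).
Proof. exact: tempered_id. Qed.

Lemma tempered_powR_norm (R : realType) (T : Type) (F : set_system T) (FF : Filter F)
    (q : R) (w : T -> R -> R) : 0 < q -> rapid F w ->
  tempered F (fun s x => `|w s x| `^ q).
Proof.
move=> q0 [wc wC]; have [C hC] := wC 0%N.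
apply: (@bounded_tempered _ _ _ _ _ (`|C| `^ q)).
  move=> s x; apply: (@continuous_comp _ _ _ (w s) (fun y => `|y| `^ q)); first exact: wc.
  exact: continuous_powR_norm.
apply: filterS hC => s h x; rewrite ger0_norm ?powR_ge0//.
apply: ge0_ler_powR; rewrite ?nnegrE// ?(ltW q0)//.
by have := h x; rewrite expr0 mul1r => /le_trans; apply; exact: ler_norm.
Qed.

Section virial.
Context {R : realType}.
Implicit Types (t x : R) (a : R -> R).
Variables (q : R) (u v : R -> R -> R).
Hypotheses (q0 : 0 < q) (hq : Num.sqrt 3 <= q + 1).
Hypotheses (su : forall t, schwartz (u t)) (sv : forall t, schwartz (v t)).
Hypothesis uv : forall t,
  schwartz_cvg (0 : R)^' (fun h x => h^-1 * (u (t + h) x - u t x)) (v t).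
Hypothesis cv : forall t, schwartz_cvg (nbhs t) v (v t).
Hypothesis eqn : forall t x, v t x + derive1n 3 (u t) x =
  derive1 (fun y => `|u t y| `^ q * u t y) x.

Let c t x := `|u t x| `^ q.
Let f t x := c t x * u t x.
Let u1 t := derive1n 1 (u t).
Let u2 t := derive1n 2 (u t).
Let u3 t := derive1n 3 (u t).
Let v1 t := derive1n 1 (v t).
(** The energy density: [q + 2] is [p + 1] and [f u] is [|u|^(p+1)]. *)
Let e t x := 2^-1 * u1 t x ^+ 2 + (q + 2)^-1 * (f t x * u t x).

Let ru t : rapid (nbhs t) u. Proof. exact: (curve_rapid su sv uv t 0). Qed.
Let ru1 t : rapid (nbhs t) u1. Proof. exact: (curve_rapid su sv uv t 1). Qed.
Let rv t : rapid (nbhs t) v. Proof. exact: (curve_derivative_rapid sv cv t 0). Qed.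
Let rv1 t : rapid (nbhs t) v1. Proof. exact: (curve_derivative_rapid sv cv t 1). Qed.
Let tc t : tempered (nbhs t) c. Proof. exact: tempered_powR_norm. Qed.
Let rf t : rapid (nbhs t) f. Proof. by apply: rapidMl. Qed.
Let re t : rapid (nbhs t) e.
Proof. have h1 := ru1 t; have h2 := rf t; have h3 := ru t; rewrite /e; decay. Qed.

(** A trailing underscore marks decay at a single fixed time, as the flux identities require. *)
Let ru_ t : rapid1 (u t). Proof. exact: schwartz_rapid 0%N (su t). Qed.
Let ru1_ t : rapid1 (u1 t). Proof. exact: schwartz_rapid. Qed.
Let ru2_ t : rapid1 (u2 t). Proof. exact: schwartz_rapid. Qed.
Let rv_ t : rapid1 (v t). Proof. exact: schwartz_rapid 0%N (sv t). Qed.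
Let rv1_ t : rapid1 (v1 t). Proof. exact: schwartz_rapid. Qed.
Let tc_ t : tempered1 (c t).
Proof. exact: (@tempered_powR_norm R unit (globally setT) _ q (fun=> u t)). Qed.
Let rf_ t : rapid1 (f t). Proof. by apply: rapidMl. Qed.
Let re_ t : rapid1 (e t). Proof. exact: (rapid_at (re t)). Qed.

Let du t x : is_derive x 1 (u t) (u1 t x). Proof. exact: schwartz_is_derive 0%N x (su t). Qed.
Let du1 t x : is_derive x 1 (u1 t) (u2 t x). Proof. exact: schwartz_is_derive. Qed.
Let du2 t x : is_derive x 1 (u2 t) (u3 t x). Proof. exact: schwartz_is_derive. Qed.
Let dv t x : is_derive x 1 (v t) (v1 t x). Proof. exact: schwartz_is_derive 0%N x (sv t). Qed.
Let df t x : is_derive x 1 (f t) ((q + 1) * c t x * u1 t x).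
Proof. exact: (is_derive_compose (is_derive_powR_norm (u t x) q0) (du t x)). Qed.

Let pde t x : v t x = (q + 1) * c t x * u1 t x - u3 t x.
Proof.
apply/eqP; rewrite eq_sym subr_eq; apply/eqP; rewrite eqn derive1E.
by have h := df t x; rewrite (derive_val (is_derive := h)).
Qed.

Let utime t x : is_derive t 1 (u^~ x) (v t x).
Proof. exact: (is_derive_curve su sv uv t x 0). Qed.
Let u1time t x : is_derive t 1 (u1^~ x) (v1 t x).
Proof. exact: (is_derive_curve su sv uv t x 1). Qed.
Let ftime t x : is_derive t 1 (f^~ x) ((q + 1) * c t x * v t x).
Proof. exact: (is_derive_compose (is_derive_powR_norm (u t x) q0) (utime t x)). Qed.

Let weight_at t a : tempered1 a -> tempered (nbhs t) (fun _ : R => a).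
Proof.
move=> [ac [m [C /(_ tt Logic.I) aC]]]; split; first by move=> _; exact: (ac tt).
by exists m, C; apply: nearW => _.
Qed.

Lemma is_derive_mass_moment t a : tempered1 a ->
  is_derive t 1 (fun s => integ (fun x => a x * u s x ^+ 2))
    (integ (fun x => a x * (2 * u t x * v t x))).
Proof.
move=> /(weight_at t) ta; have h1 := ru t; have h2 := rv t.
notypeclasses refine (@is_derive_integ _ t (fun s x => a x * u s x ^+ 2)
  (fun s x => a x * (2 * u s x * v s x)) _ _ _).
- by decay.
- by decay.
- by move=> s x; have h := utime s x; derive; ring.
Qed.

(** The potential part contributes [f v], because the time derivative of [f u] is [(q + 2) f v]. *)
Lemma is_derive_energy_moment t a : tempered1 a ->
  is_derive t 1 (fun s => integ (fun x => a x * e s x))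
    (integ (fun x => a x * (u1 t x * v1 t x + f t x * v t x))).
Proof.
move=> /(weight_at t) ta; have h1 := ru1 t; have h2 := rv t; have h3 := rv1 t.
have h4 := rf t; have h5 := re t.
notypeclasses refine (@is_derive_integ _ t (fun s x => a x * e s x)
  (fun s x => a x * (u1 s x * v1 s x + f s x * v s x)) _ _ _).
- by decay.
- by decay.
- move=> s x; have d0 := utime s x; have d1 := u1time s x; have d2 := ftime s x.
  rewrite /e; derive; rewrite /f; field; rewrite gt_eqF// addr_gt0//.
Qed.

(** * Conservation laws and the motion of the two centers *)

Let M t := integ (fun x => u t x ^+ 2).
Let A t := integ (fun x => u1 t x ^+ 2).
Let B t := integ (fun x => f t x * u t x).
Let E t := integ (e t).
Let P t := integ (fun x => x * u t x ^+ 2).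
Let Q t := integ (fun x => x * e t x).
Let k := 2 * (q + 1) / (q + 2).

Let q2 : 0 < q + 2. Proof. exact: addr_gt0. Qed.
Let k0 : 0 < k. Proof. by rewrite divr_gt0// mulr_gt0// addr_gt0. Qed.
Let c0 t x : 0 <= c t x. Proof. exact: powR_ge0. Qed.
Let fu0 t x : 0 <= f t x * u t x.
Proof. by rewrite /f -mulrA mulr_ge0// -expr2 sqr_ge0. Qed.
Let A0 t : 0 <= A t. Proof. by apply: integ_ge0 => x; exact: sqr_ge0. Qed.
Let B0 t : 0 <= B t. Proof. exact: integ_ge0. Qed.
Let e0 t x : 0 <= e t x.
Proof. by rewrite addr_ge0// mulr_ge0 ?invr_ge0 ?sqr_ge0// ltW. Qed.
Let E0 t : 0 <= E t. Proof. exact: integ_ge0. Qed.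

Let EE t : E t = 2^-1 * A t + B t / (q + 2).
Proof.
have h1 := ru1_ t; have h2 := rf_ t; have h3 := ru_ t.
rewrite /E /e integD; [|by decay..].
by rewrite !integZ; [rewrite [B t / _]mulrC|by decay..].
Qed.

Lemma is_derive_mass_weight t (a0 a1 a2 a3 : R -> R) :
  (forall x, is_derive x 1 a0 (a1 x)) -> (forall x, is_derive x 1 a1 (a2 x)) ->
  (forall x, is_derive x 1 a2 (a3 x)) ->
  tempered1 a0 -> tempered1 a1 -> tempered1 a2 -> tempered1 a3 ->
  is_derive t 1 (fun s => integ (fun x => a0 x * u s x ^+ 2))
    (integ (fun x => a3 x * u t x ^+ 2 - a1 x * (3 * u1 t x ^+ 2 + k * (f t x * u t x)))).
Proof.
move=> d0 d1 d2 t0 t1 t2 t3.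
by rewrite -(integ_mass_flux q0 (du t) (du1 t) (du2 t) (df t) (ru_ t) (ru1_ t) (ru2_ t)
  (rv_ t) (rf_ t) (fun=> erefl) (pde t) d0 d1 d2 t0 t1 t2 t3);
  exact: is_derive_mass_moment.
Qed.

Let dP t : is_derive t 1 P (- (3 * A t + k * B t)).
Proof.
have h1 := ru1_ t; have h2 := rf_ t; have h3 := ru_ t.
have d1 x : is_derive x 1 (fun _ : R => 1 : R) 0 by exact: is_derive_const.
have d2 x : is_derive x 1 (fun _ : R => 0 : R) 0 by exact: is_derive_const.
have h := is_derive_mass_weight t (@is_derive_var R) d1 d2
  (@tempered1_id R) (tempered1_cst _) (tempered1_cst _) (tempered1_cst _).
notypeclasses refine (is_derive_congr h _).
have -> : (fun x => 0 * u t x ^+ 2 - 1 * (3 * u1 t x ^+ 2 + k * (f t x * u t x))) =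
  (fun x => -1 * (3 * u1 t x ^+ 2 + k * (f t x * u t x))).
  by apply/funext => x; ring.
rewrite integZ; last by decay.
rewrite mulN1r integD; [|by decay..].
by rewrite !integZ; by decay.
Qed.

Let dM t : is_derive t 1 M 0.
Proof.
have d2 x : is_derive x 1 (fun _ : R => 0 : R) 0 by exact: is_derive_const.
have h := is_derive_mass_weight t (@is_derive_const R 1) d2 d2
  (tempered1_cst _) (tempered1_cst _) (tempered1_cst _) (tempered1_cst _).
have -> : M = fun s => integ (fun x => 1 * u s x ^+ 2).
  by apply/funext => s; congr integ; apply/funext => x; rewrite mul1r.
notypeclasses refine (is_derive_congr h _).
have -> : (fun x => 0 * u t x ^+ 2 - 0 * (3 * u1 t x ^+ 2 + k * (f t x * u t x))) =
  (fun x => 0 * u t x ^+ 2).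
  by apply/funext => x; ring.
by rewrite integZ ?mul0r//; have h3 := ru_ t; decay.
Qed.

Let dE t : is_derive t 1 E 0.
Proof.
have h := is_derive_energy_moment t (tempered1_cst 1).
have -> : E = fun s => integ (fun x => 1 * e s x).
  by apply/funext => s; congr integ; apply/funext => x; rewrite mul1r.
notypeclasses refine (is_derive_congr h _).
rewrite -[RHS](integ_energy_flux (du1 t) (du2 t) (dv t) (df t) (ru1_ t)
  (ru2_ t) (rv_ t) (rv1_ t) (rf_ t) (fun=> erefl) (pde t)).
by congr integ; apply/funext => x; rewrite mul1r.
Qed.

Let dQ t : is_derive t 1 Q (- (3 / 2 * integ (fun x => u2 t x ^+ 2)
  - 2 * integ (fun x => f t x * u2 t x) + 2^-1 * integ (fun x => f t x ^+ 2))).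
Proof.
have h := is_derive_energy_moment t (@tempered1_id R).
notypeclasses refine (is_derive_congr h _).
exact: (integ_energy_center_flux (du1 t) (du2 t) (dv t) (df t) (ru1_ t)
  (ru2_ t) (rv_ t) (rv1_ t) (rf_ t) (fun=> erefl) (pde t)).
Qed.

Lemma mass_conserved t : integ (fun x => u t x ^+ 2) = integ (fun x => u 0 x ^+ 2).
Proof. exact: (is_derive0_cst t 0 dM). Qed.

Let MC t : M t = M 0. Proof. exact: mass_conserved. Qed.
Let EC t : E t = E 0. Proof. exact: (is_derive0_cst t 0 dE). Qed.

(** A bound on the speed of [P], from [A <= 2 E] and [B <= (q + 2) E]. *)
Let Y := 6 * E 0 + k * ((q + 2) * E 0).

Let flux_le t : 0 <= 3 * A t + k * B t <= Y.
Proof.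
have := EE t; rewrite EC => h; have a0 := A0 t; have b0 := B0 t; have := k0 => kk.
apply/andP; split; first by rewrite addr_ge0// mulr_ge0// ltW.
have b1 : 0 <= B t / (q + 2) by rewrite divr_ge0 ?(ltW q2).
have b2 : B t <= (q + 2) * E 0.
  by rewrite mulrC -ler_pdivrMr//; lra.
have b3 : k * B t <= k * ((q + 2) * E 0) by rewrite ler_wpM2l ?(ltW k0).
rewrite /Y; lra.
Qed.

Let displacement (a b : R) : a <= b -> `|P b - P a| <= Y * (b - a).
Proof.
rewrite le_eqVlt => /predU1P[->|ab]; first by rewrite !subrr normr0 mulr0.
have [t _ ->] := mean_value dP ab.
rewrite normrM (gtr0_norm (_ : 0 < b - a)) ?subr_gt0// ler_wpM2r ?subr_ge0 ?(ltW ab)//.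
by have /andP[h1 h2] := flux_le t; rewrite normrN ger0_norm.
Qed.

Let moment t y : integ (fun x => (x - y) ^+ 2 * u t x ^+ 2) =
  integ (fun x => x ^+ 2 * u t x ^+ 2) - 2 * y * P t + y ^+ 2 * M t.
Proof.
have h := ru_ t.
have -> : (fun x => (x - y) ^+ 2 * u t x ^+ 2) = (fun x => x ^+ 2 * u t x ^+ 2
    - 2 * y * (x * u t x ^+ 2) + y ^+ 2 * u t x ^+ 2).
  by apply/funext => x; ring.
rewrite integD; [|by decay..].
rewrite integB; [|by decay..].
by rewrite !integZ; by decay.
Qed.

(** * Contradiction for positive mass and uniformly bounded second moments *)

Section trapped.
Variables (X : R -> R) (C : R).
Hypothesis M0 : 0 < M 0.
Hypothesis trap : forall t, integ (fun x => (x - X t) ^+ 2 * u t x ^+ 2) <= C.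

Let M' := M 0.
Let E' := E 0.
Let y t := P t / M'.
Let Py t : P t = M' * y t. Proof. by rewrite /y mulrC divfK// gt_eqF. Qed.

(** The center of mass minimizes the second moment, so it may replace the arbitrary [X t]; unlike
    [X], it moves at bounded speed. *)
Let variance t : integ (fun x => (x - y t) ^+ 2 * u t x ^+ 2) <= C.
Proof.
apply: le_trans (trap t); rewrite !moment MC Py -/M'.
have h : 0 <= M' * (X t - y t) ^+ 2 by rewrite mulr_ge0 ?sqr_ge0// ltW.
rewrite -subr_ge0; move: h; set m := integ _; congr (_ <= _); ring.
Qed.

Let C0 : 0 <= C.
Proof. by apply: le_trans (variance 0); apply: integ_ge0 => x; rewrite mulr_ge0 ?sqr_ge0. Qed.

Let nonlinear_lower : exists2 b, 0 < b & forall t, b <= B t.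
Proof.
(* [r] makes [C / r^2] at most [M' / 4], the [+ 1] keeping it positive if [C = 0]; [n] makes
   [2 r n^2] equal to [M' / 4]. Half of the mass is left to the nonlinear term. *)
pose r := Num.sqrt (4 * C / M') + 1.
have r0 : 0 < r by rewrite ltr_wpDl ?sqrtr_ge0.
pose n := Num.sqrt (M' / (8 * r)).
have n0 : 0 < n by rewrite sqrtr_gt0 divr_gt0 ?mulr_gt0.
have nq : 0 < n `^ q by rewrite powR_gt0.
exists (n `^ q * (M' / 2)); first by rewrite mulr_gt0 ?divr_gt0.
move=> t.
have := mass_le_nonlinear q0 r0 n0 (ru_ t) (rf_ t) (variance t).
rewrite -/(M t) -/(B t) MC -/M'.
have -> : 2 * r * n ^+ 2 = M' / 4.
  rewrite sqr_sqrtr; last by rewrite divr_ge0 ?mulr_ge0 ?(ltW r0) ?(ltW M0).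
  by field; rewrite gt_eqF.
have h : C / r ^+ 2 <= M' / 4.
  rewrite ler_pdivrMr ?exprn_gt0//.
  have h1 : 4 * C / M' <= r ^+ 2.
    rewrite -[leLHS]sqr_sqrtr ?divr_ge0 ?mulr_ge0 ?(ltW M0)//.
    by rewrite lerXn2r ?nnegrE ?sqrtr_ge0 ?(ltW r0)// lerDl.
  by move: h1; rewrite ler_pdivrMr//; lra.
move=> h2; have : M' / 2 <= (n `^ q)^-1 * B t by lra.
by rewrite [_^-1 * _]mulrC ler_pdivlMr// mulrC.
Qed.

(** [M' * E'] times the signed distance between the two centers, written without dividing by the
    energy. *)
Let K t := E' * P t - M' * Q t.

Let K_growth : exists2 d, 0 < d & forall a b : R, a <= b -> d * (b - a) <= K b - K a.
Proof.
have [b0 b00 hb] := nonlinear_lower.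
exists (2^-1 * (q / (q + 2)) ^+ 2 * b0 ^+ 2).
  by rewrite !mulr_gt0 ?invr_gt0 ?exprn_gt0 ?divr_gt0.
move=> a b; rewrite le_eqVlt => /predU1P[->|ab]; first by rewrite !subrr mulr0.
pose K' t := M' * (3 / 2 * integ (fun x => u2 t x ^+ 2)
  - 2 * integ (fun x => f t x * u2 t x) + 2^-1 * integ (fun x => f t x ^+ 2))
  - E' * (3 * A t + k * B t).
have dK t : is_derive t 1 K (K' t).
  have h1 := dP t; have h2 := dQ t.
  rewrite /K /K'; derive; rewrite !mulr0 !addr0; ring.
have [t _ ->] := mean_value dK ab.
apply: ler_wpM2r; first by rewrite subr_ge0 ltW.
have Mt : 0 < M t by rewrite MC.
(* The conserved [M'] and [E'] are traded for their values at time [t], to fit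
   [centers_separate]. *)
have -> : K' t = M t * (3 / 2 * integ (fun x => u2 t x ^+ 2)
      - 2 * integ (fun x => f t x * u2 t x) + 2^-1 * integ (fun x => f t x ^+ 2))
    - (2^-1 * A t + B t / (q + 2)) * (3 * A t + k * B t).
  congr (_ * _ - _ * _); first exact/esym/MC.
  exact: etrans (esym (EC t)) (EE t).
apply: le_trans (centers_separate q0 (du t) (du1 t) (df t) (ru_ t) (ru1_ t) (ru2_ t) (tc_ t)
  (rf_ t) (fun=> erefl) (c0 t) hq Mt).
apply: ler_wpM2l; first by rewrite mulr_ge0 ?invr_ge0 ?sqr_ge0.
by rewrite lerXn2r ?nnegrE ?(ltW b00) ?B0 ?hb.
Qed.

Let K_bounded : exists D, forall a : R, exists2 t, a < t < a + 1 & `|K t| <= D.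
Proof.
(* The three groups come from [w3 <= 3], from the weighted mass at time [a], and from the one at
   [a + 1], when the center has moved by at most [Y / M']. *)
pose D1 := 3 * M' + (C + M') + (2 * C + 2 * (Y / M') ^+ 2 * M' + M').
exists (E' * Y + M' * D1) => a.
have [w0 [w1 [w2 [w3 [[d0 d1 d2] [tw hw]]]]]] := quadratic_weight (y a).
have [tw0 tw1 tw2 tw3] := tw unit (globally setT) _.
have dPhi t := is_derive_mass_weight t d0 d1 d2 tw0 tw1 tw2 tw3.
have aa : a < a + 1 by rewrite ltrDl.
have [t tab] := mean_value dPhi aa; rewrite addrAC subrr add0r mulr1.
set J := integ (fun x => w3 x * _ - _) => hJ.
exists t => //.
have rut := ru_ t; have ru1t := ru1_ t; have rft := rf_ t; have ret := re_ t.
(* [hJ] bounds the time derivative [J] of the weighted mass at [t] by its values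
   at [a] and [a + 1]; [J] controls the first moment of [e] about [y a]. *)
have Phi_le s : `|integ (fun x => w0 x * u s x ^+ 2)| <=
    integ (fun x => (x - y a) ^+ 2 * u s x ^+ 2) + M'.
  have rus := ru_ s.
  have -> : integ (fun x => (x - y a) ^+ 2 * u s x ^+ 2) + M' =
      integ (fun x => ((x - y a) ^+ 2 + 1) * u s x ^+ 2).
    rewrite -[M'](MC s) -integD; [|by decay..].
    by congr integ; apply/funext => x; ring.
  have h x : `|w0 x * u s x ^+ 2| <= ((x - y a) ^+ 2 + 1) * u s x ^+ 2.
    rewrite normrM [`|u s x ^+ 2|]ger0_norm ?sqr_ge0// ler_wpM2r ?sqr_ge0//.
    by have [] := hw x.
  rewrite ler_norml; apply/andP; split.
    rewrite -mulN1r -integZ; last by decay.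
    apply: le_integ; [by decay|by decay|] => x; rewrite mulN1r.
    by have := h x; rewrite ler_norml => /andP[].
  apply: le_integ; [by decay|by decay|] => x.
  by have := h x; rewrite ler_norml => /andP[].
have far : integ (fun x => (x - y a) ^+ 2 * u (a + 1) x ^+ 2) <= 2 * C + 2 * (Y / M') ^+ 2 * M'.
  have := variance (a + 1); rewrite !moment MC -/M' !Py.
  have hy : (y (a + 1) - y a) ^+ 2 <= (Y / M') ^+ 2.
    have hd := displacement (ltW aa); rewrite addrAC subrr add0r mulr1 in hd.
    have -> : y (a + 1) - y a = (P (a + 1) - P a) / M' by rewrite /y mulrBl.
    rewrite -(real_normK (num_real (_ / _))) normrM [`|M'^-1|]gtr0_norm ?invr_gt0//.
    have Y0 : 0 <= Y by have /andP[/le_trans] := flux_le 0; apply.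
    rewrite lerXn2r ?nnegrE ?mulr_ge0 ?invr_ge0 ?(ltW M0)//.
    by rewrite ler_wpM2r ?invr_ge0 ?(ltW M0).
  have hyM := ler_wpM2r (ltW M0) hy; rewrite -/M' in hyM.
  move: hyM; set m := integ _; set y' := y (a + 1); set y0 := y a; set YM := (Y / M') ^+ 2 * M'.
  have : 0 <= m - 2 * y' * (M' * y') + y' ^+ 2 * M'.
    have := variance (a + 1); have h : 0 <= integ (fun x => (x - y') ^+ 2 * u (a + 1) x ^+ 2).
      by apply: integ_ge0 => x; rewrite mulr_ge0 ?sqr_ge0.
    by move: h; rewrite moment MC Py.
  set V := m - _ + _ => V0 hYM VC.
  (* Parallel axis identity: the moment about the old center is the variance plus the mass times the
     squared displacement. The factors 2 in the bound are slack. *)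
  have -> : m - 2 * y0 * (M' * y') + y0 ^+ 2 * M' = V + (y' - y0) ^+ 2 * M'.
    by rewrite /V; ring.
  have -> : 2 * (Y / M') ^+ 2 * M' = 2 * YM by rewrite /YM mulrA.
  have : 0 <= (y' - y0) ^+ 2 * M' by rewrite mulr_ge0 ?sqr_ge0 ?(ltW M0).
  lra.
have J_lower : - J <= C + M' + (2 * C + 2 * (Y / M') ^+ 2 * M' + M').
  rewrite -hJ opprB (le_trans (ler_norm _))// (le_trans (ler_normB _ _))// lerD//.
    by rewrite (le_trans (Phi_le a))// lerD2r variance.
  by rewrite (le_trans (Phi_le (a + 1)))// lerD2r.
(* With [1 / 2 <= 3], this puts the energy density below the density of the mass flux, term by
   term. *)
have kq : (q + 2)^-1 <= k.
  have h : 1 <= 2 * (q + 1) by have := q0; lra.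
  by rewrite /k ler_pdivlMr// mulVf// gt_eqF.
have pw x : `|x - y a| * e t x <= 3 * u t x ^+ 2
    - (w3 x * u t x ^+ 2 - w1 x * (3 * u1 t x ^+ 2 + k * (f t x * u t x))).
  have [_ h1 h3] := hw x.
  have u0 := sqr_ge0 (u t x); have u10 := sqr_ge0 (u1 t x).
  have he : e t x <= 3 * u1 t x ^+ 2 + k * (f t x * u t x).
    by rewrite /e lerD// ?ler_wpM2r//; lra.
  have h4 : `|x - y a| * e t x <= w1 x * (3 * u1 t x ^+ 2 + k * (f t x * u t x)).
    by apply: ler_pM.
  have h5 : w3 x * u t x ^+ 2 <= 3 * u t x ^+ 2 by rewrite ler_wpM2r.
  lra.
have rJ : rapid1 (fun x => 3 * u t x ^+ 2
    - (w3 x * u t x ^+ 2 - w1 x * (3 * u1 t x ^+ 2 + k * (f t x * u t x)))) by decay.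
have IJ : integ (fun x => 3 * u t x ^+ 2
    - (w3 x * u t x ^+ 2 - w1 x * (3 * u1 t x ^+ 2 + k * (f t x * u t x)))) = 3 * M' - J.
  rewrite integB; [|by decay..].
  by rewrite integZ -/(M t) ?MC//; decay.
have QE : `|Q t - y a * E'| <= D1.
  have -> : Q t - y a * E' = integ (fun x => (x - y a) * e t x).
    rewrite /E' -(EC t) -integZ// -integB; [|by decay..].
    by congr integ; apply/funext => x; ring.
  apply: (@le_trans _ _ (3 * M' - J)); last by rewrite /D1; lra.
  rewrite -IJ ler_norml; apply/andP; split.
    rewrite -mulN1r -integZ//; apply: le_integ; [by decay|by decay|] => x.
    rewrite mulN1r lerNl (le_trans _ (pw x))// -mulNr ler_wpM2r//.
    by rewrite -normrN ler_norm.
  apply: le_integ => // [|x]; first by decay.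
  by rewrite (le_trans _ (pw x))// ler_wpM2r// ler_norm.
have at_ : a < t by have /andP[] := tab.
have Pd : `|P t - P a| <= Y.
  apply: le_trans (displacement (ltW at_)) _.
  have Y0 : 0 <= Y by have /andP[/le_trans] := flux_le 0; apply.
  by rewrite ler_piMr//; have /andP[_] := tab; lra.
(* Recentering at [y a] costs nothing because [P a = M' * y a]. *)
have -> : K t = E' * (P t - P a) - M' * (Q t - y a * E').
  by rewrite /K (Py a); ring.
rewrite (le_trans (ler_normB _ _))// !normrM lerD//.
  by rewrite ger0_norm ?E0// ler_wpM2l ?E0.
by rewrite gtr0_norm// ler_wpM2l// ltW.
Qed.

(** Two times of bounded [K], taken far enough apart, contradict its linear growth. *)
Lemma trapped_absurd : False.
Proof.
have [d d0 hK] := K_growth; have [D hD] := K_bounded.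
have [s /andP[s0 s1] Ks] := hD 0.
pose n := (Num.trunc (`|2 * D / d|)).+1.
have hn : 2 * D / d < n%:R.
  by apply: le_lt_trans (ler_norm _) _; exact: truncnS_gt.
(* The [+ 1] compensates for [s < 1], so that [t - s] exceeds [n]. *)
have [t /andP[t0 t1] Kt] := hD (n%:R + 1).
have n0 : (0 : R) <= n%:R by exact: ler0n.
have st : s <= t by lra.
have := hK _ _ st; apply/negP; rewrite -ltNge.
have h1 : K t - K s <= 2 * D.
  by move: Ks Kt; rewrite !ler_norml => /andP[? ?] /andP[? ?]; lra.
have h2 : n%:R * d <= (t - s) * d by apply: ler_wpM2r; [exact: ltW|lra].
apply: (le_lt_trans h1); rewrite [ltRHS]mulrC; apply: lt_le_trans h2.
by rewrite -ltr_pdivrMr.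
Qed.

End trapped.
End virial.

(** * From the tail hypothesis to vanishing mass, with [q = p - 1] *)

Theorem corollary3 (R : realType) (p : R) (hp : Num.sqrt 3 <= p)
    (u : R -> R -> R)
    (hu : global_schwartz_solution p u)
    (hsol : soliton_like u) :
  forall t x : R, u t x = 0.
Proof.
have [[su [v [sv uv cv]]] eqn] := hu.
have [X [eps [C [eps0 C0 tail]]]] := hsol.
have p1 : 1 < p.
  by apply: lt_le_trans hp; rewrite -[ltLHS]sqrtr1 ltr_sqrt// ltr1n.
have q0 : 0 < p - 1 by rewrite subr_gt0.
have hq : Num.sqrt 3 <= p - 1 + 1 by rewrite subrK.
have eqn' t x : v t x + derive1n 3 (u t) x = derive1 (fun y => `|u t y| `^ (p - 1) * u t y) x.
  rewrite -eqn; congr (_ + _); rewrite derive1E.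
  have h := is_derive_curve su sv uv t x 0.
  exact: esym (derive_val (is_derive := h)).
have ru t : rapid1 (u t) by exact: schwartz_rapid 0%N (su t).
have mass_cst t : integ (fun x => u t x ^+ 2) = integ (fun x => u 0 x ^+ 2).
  exact: (mass_conserved q0 su sv uv cv eqn').
have m0 : 0 <= integ (fun x => u 0 x ^+ 2) by apply: integ_ge0 => x; exact: sqr_ge0.
move: m0; rewrite le_eqVlt => /predU1P[m0|m0].
  move=> t x; apply/eqP; rewrite -sqrf_eq0; apply/eqP.
  apply: (@integ_eq0 _ (fun x => u t x ^+ 2)).
  - by have := ru t => rut; decay.
  - by move=> y; exact: sqr_ge0.
  - by rewrite mass_cst.
(* The second moments about [X t] are bounded in terms of the conserved mass, [C] and [eps], hence
   uniformly in [t]. *)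
exfalso; apply: (trapped_absurd q0 hq su sv uv cv eqn' (X := X) m0) => t.
apply: le_trans (second_moment_le (ru t) eps0 C0 _) _.
  move=> r r0; apply: le_trans (tail r r0); apply: ereal_sup_ubound.
  by exists t.
by rewrite mass_cst.
Qed.
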